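(* Let $C$ be a commutative ring, let $\sigma\in\mathrm{Aut}(C)$, and let $A$ be an Azumaya $C$-algebra such that $A^{\mathrm{op}}$ is Brauer equivalent to $A^\sigma$. Let $K$ be any $(A^{\mathrm{op}},A^\sigma)$-progenerator of type $\mathrm{id}_C$, which is also viewed as a double $A$-progenerator. Let $P$ be a right $A$-progenerator and set $P^{[1]}=\mathrm{Hom}_A(P,K_0)$. Then the following conditions are equivalent: (a) $B:=\mathrm{End}_A(P)$ has an anti-automorphism of type $\sigma$. (b) There is $[I]\in\mathrm{Pic}(C)$ such that $I\otimes_C P\cong P^{[1]}$ as right $A$-modules. (c) $\mathrm{End}_A(P)\cong\mathrm{End}_A(P^{[1]})$ as $C$-algebras. In particular, if $I\otimes_C P\not\cong P^{[1]}$ for all $[I]\in\mathrm{Pic}(C)$, then $\mathrm{End}_A(P)$ does not have an anti-automorphism of type $\sigma$.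
   Context: Rings are unital. A $C$-algebra $A$ is Azumaya if $A$ is a progenerator as a $C$-module and $A\otimes_C A^{\mathrm{op}}\to\mathrm{End}_C(A)$, $a\otimes b^{\mathrm{op}}\mapsto(x\mapsto axb)$, is an isomorphism. Azumaya $C$-algebras $A,B$ are Brauer equivalent if $A\otimes_C\mathrm{End}_C(P)\cong B\otimes_C\mathrm{End}_C(Q)$ as $C$-algebras for some $C$-progenerators $P,Q$; equivalently, there is an $(A,B)$-progenerator on which the two $C$-actions agree. $A^\sigma$ denotes the ring $A$ viewed as a $C$-algebra via $\sigma$, i.e. $c\in C$ acts on $A^\sigma$ as $\sigma(c)$ acts on $A$. $\mathrm{Pic}(C)$ is the group of isomorphism classes of rank-one projective $C$-modules. A right progenerator is a finitely generated projective generator. An $(S,R)$-progenerator is an $(S,R)$-bimodule $P$ such that $P_R$ is a progenerator and every endomorphism of $P_R$ is $p\mapsto sp$ for a unique $s\in S$. For central $C$-algebras $S,R$ it has type $\tau\in\mathrm{Aut}(C)$ if $\tau(c)p=pc$ for all $p\in P$, $c\in C$ (so type $\mathrm{id}_C$ means the two $C$-actions agree). The bimodule $K$ carries two commuting right $A$-module structures ($A^\sigma=A$ as rings): $k\odot_0a=k\cdot a$ and $k\odot_1 a=a^{\mathrm{op}}\cdot k$; this is the double $A$-module structure on $K$. $K_0$ denotes $K$ as a right $A$-module via $\odot_0$. $P^{[1]}=\mathrm{Hom}_A(P,K_0)$ is a right $A$-module via $(fa)(p)=f(p)\odot_1a$. For a right $A$-module $M$, $\mathrm{End}_A(M)$ is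 a $C$-algebra via $(fc)(m)=f(mc)$; when $M$ is a progenerator it is central over $C$ (that is, $C$ is identified with its center), and the type of an anti-automorphism is its restriction to $C$. *)

(* Defs.v *)
From HB Require Import structures.
From mathcomp Require Import all_boot all_order all_algebra.
From mathcomp Require Import boolp ring.
Set Implicit Arguments.
Unset Strict Implicit.
Unset Printing Implicit Defensive.
Import GRing.Theory.
Local Open Scope ring_scope.
Local Open Scope quotient_scope.

(* Conventions.
   - The zero ring is allowed: rings are pzRingType, not nzRingType.
   - A right module over A is a left module over the opposite ring A^c, so
     [a *: p] with [a : A^c] and [p : P] is the mathematical p a.
   - Endomorphisms are composed as functions, (f * g) m = f (g m). *)

Definition mk_linear (R : pzRingType) (U V : lmodType R) (f : U -> V)
    (f_lin : linear f) : {linear U -> V} :=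
  HB.pack f (GRing.isLinear.Build R U V *:%R f f_lin).

Lemma linear_ext (R : pzRingType) (U V : lmodType R) (f g : {linear U -> V}) :
  f =1 g -> f = g.
Proof.
case: f g => [f [[fN] [fZ]]] [g [[gN] [gZ]]] /= /funext fg; subst g.
by rewrite (Prop_irrelevance fZ gZ) (Prop_irrelevance fN gN).
Qed.

Definition hom (R : pzRingType) (U V : lmodType R) : Type := {linear U -> V}.
Definition hom_fun R U V (f : @hom R U V) : {linear U -> V} := f.
Coercion hom_fun : hom >-> GRing.Linear.type.

Section HomZmodule.
Variables (R : pzRingType) (U V : lmodType R).
Implicit Types f g : hom U V.

HB.instance Definition _ := gen_eqMixin (hom U V).
HB.instance Definition _ := gen_choiceMixin (hom U V).

Fact hom_zero_lin : linear (fun _ : U => 0 : V).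
Proof. by move=> a u v; rewrite scaler0 addr0. Qed.
Fact hom_opp_lin f : linear (fun u => - f u).
Proof. by move=> a u v; rewrite linearP opprD scalerN. Qed.
Fact hom_add_lin f g : linear (fun u => f u + g u).
Proof. by move=> a u v; rewrite !linearP scalerDr addrACA. Qed.

Definition hom_zero : hom U V := mk_linear hom_zero_lin.
Definition hom_opp f : hom U V := mk_linear (hom_opp_lin f).
Definition hom_add f g : hom U V := mk_linear (hom_add_lin f g).

Fact hom_addA : associative hom_add.
Proof. by move=> f g h; apply: linear_ext => u /=; rewrite addrA. Qed.
Fact hom_addC : commutative hom_add.
Proof. by move=> f g; apply: linear_ext => u /=; rewrite addrC. Qed.
Fact hom_add0 : left_id hom_zero hom_add.
Proof. by move=> f; apply: linear_ext => u /=; rewrite add0r. Qed.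
Fact hom_addN : left_inverse hom_zero hom_opp hom_add.
Proof. by move=> f; apply: linear_ext => u /=; rewrite addNr. Qed.

HB.instance Definition _ :=
  GRing.isZmodule.Build (hom U V) hom_addA hom_addC hom_add0 hom_addN.

End HomZmodule.

Definition endo (R : pzRingType) (M : lmodType R) : Type := hom M M.
Definition endo_fun R M (f : @endo R M) : {linear M -> M} := f.
Coercion endo_fun : endo >-> GRing.Linear.type.

Section EndoRing.
Variables (R : pzRingType) (M : lmodType R).
Implicit Types f g : endo M.

HB.instance Definition _ := GRing.Zmodule.copy (endo M) (hom M M).

Fact endo_one_lin : linear (fun u : M => u). Proof. by []. Qed.
Fact endo_mul_lin f g : linear (fun u => f (g u)).
Proof. by move=> a u v; rewrite !linearP. Qed.

Definition endo_one : endo M := mk_linear endo_one_lin.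
Definition endo_mul f g : endo M := mk_linear (endo_mul_lin f g).

Fact endo_mulA : associative endo_mul.
Proof. by move=> f g h; apply: linear_ext. Qed.
Fact endo_mul1l : left_id endo_one endo_mul.
Proof. by move=> f; apply: linear_ext. Qed.
Fact endo_mul1r : right_id endo_one endo_mul.
Proof. by move=> f; apply: linear_ext. Qed.
Fact endo_mulDl : left_distributive endo_mul +%R.
Proof. by move=> f g h; apply: linear_ext. Qed.
Fact endo_mulDr : right_distributive endo_mul +%R.
Proof. by move=> f g h; apply: linear_ext => u /=; rewrite linearD. Qed.

HB.instance Definition _ := GRing.Zmodule_isPzRing.Build (endo M)
  endo_mulA endo_mul1l endo_mul1r endo_mulDl endo_mulDr.

End EndoRing.

(* An algebra is a ring with a ring morphism from C to its center. The library's
   algType is not suitable: it excludes the zero ring (hence End_A(0)), and it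
   allows only one C-action on a given ring, whereas A and A^sigma have the same
   underlying ring. *)
Record algebra (C : comPzRingType) := Algebra {
  alg_ring :> pzRingType;
  alg_in : {rmorphism C -> alg_ring};
  alg_inC : forall c a, alg_in c * a = a * alg_in c
}.

Definition alg_iso (C : comPzRingType) (A B : algebra C)
    (f : {rmorphism A -> B}) : Prop :=
  bijective f /\ forall c, f (alg_in A c) = alg_in B c.

Definition alg_isomorphic (C : comPzRingType) (A B : algebra C) : Prop :=
  exists f : {rmorphism A -> B}, alg_iso f.

Section BasicAlgebras.
Variable C : comPzRingType.

Definition base_alg : algebra C :=
  @Algebra C C (idfun : {rmorphism C -> C}) (@mulrC C).

Variable A : algebra C.

Definition op_in : C -> A^c := alg_in A.
Fact op_in_zmod : zmod_morphism op_in.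
Proof. by move=> c d; rewrite /op_in rmorphB. Qed.
Fact op_in_monoid : monoid_morphism op_in.
Proof.
split=> [|c d]; first by rewrite /op_in rmorph1.
by rewrite /op_in rmorphM; apply: alg_inC.
Qed.
HB.instance Definition _ := GRing.isZmodMorphism.Build C A^c op_in op_in_zmod.
HB.instance Definition _ := GRing.isMonoidMorphism.Build C A^c op_in op_in_monoid.
Fact op_inC c (a : A^c) : op_in c * a = a * op_in c.
Proof. exact: esym (alg_inC c (a : A)). Qed.

Definition op_alg : algebra C := @Algebra C A^c op_in op_inC.

(* A^sigma: c acts as sigma c does on A. *)
Definition twist_alg (sigma : {rmorphism C -> C}) : algebra C :=
  @Algebra C A (alg_in A \o sigma : {rmorphism C -> A})
    (fun c => alg_inC (sigma c)).

Variable M : lmodType A.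

Fact end_in_lin c : linear (fun m : M => alg_in A c *: m).
Proof. by move=> a u v; rewrite scalerDr !scalerA alg_inC. Qed.
Definition end_in c : endo M := mk_linear (end_in_lin c).
Fact end_in_zmod : zmod_morphism end_in.
Proof. by move=> c d; apply: linear_ext => u /=; rewrite rmorphB scalerBl. Qed.
Fact end_in_monoid : monoid_morphism end_in.
Proof.
split=> [|c d]; apply: linear_ext => u /=; first by rewrite rmorph1 scale1r.
by rewrite rmorphM scalerA.
Qed.
HB.instance Definition _ :=
  GRing.isZmodMorphism.Build C (endo M) end_in end_in_zmod.
HB.instance Definition _ :=
  GRing.isMonoidMorphism.Build C (endo M) end_in end_in_monoid.
Fact end_inC c (f : endo M) : end_in c * f = f * end_in c.
Proof. by apply: linear_ext => u /=; rewrite linearZ. Qed.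

Definition end_alg : algebra C := @Algebra C (endo M) end_in end_inC.

End BasicAlgebras.

Definition restr (R S : pzRingType) (f : {rmorphism R -> S})
  (M : lmodType S) : Type := M.

Section Restriction.
Variables (R S : pzRingType) (f : {rmorphism R -> S}) (M : lmodType S).

HB.instance Definition _ := GRing.Zmodule.copy (restr f M) M.

Definition restr_scale (a : R) (m : restr f M) : restr f M := f a *: (m : M).
Fact restr_scaleA a b m :
  restr_scale a (restr_scale b m) = restr_scale (a * b) m.
Proof. by rewrite /restr_scale scalerA rmorphM. Qed.
Fact restr_scale1 : left_id 1 restr_scale.
Proof. by move=> m; rewrite /restr_scale rmorph1 scale1r. Qed.
Fact restr_scaleDr : right_distributive restr_scale +%R.
Proof. by move=> a m n; rewrite /restr_scale scalerDr. Qed.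
Fact restr_scaleDl m : {morph restr_scale^~ m : a b / a + b}.
Proof. by move=> a b; rewrite /restr_scale rmorphD scalerDl. Qed.

HB.instance Definition _ := GRing.Zmodule_isLmodule.Build R (restr f M)
  restr_scaleA restr_scale1 restr_scaleDr restr_scaleDl.

End Restriction.

Definition alg_mod (C : comPzRingType) (A : algebra C) : lmodType C :=
  restr (alg_in A) A^o.

(* For a C-algebra R, a C-module M and an R-module N, the tensor product of M
   and N over C as an R-module, presented by generators and relations: formal
   sums of pairs modulo bilinearity. It is the usual tensor product of C-modules
   when R is C. *)
Section Tensor.
Variables (C : comPzRingType) (R : algebra C) (M : lmodType C) (N : lmodType R).

Inductive tens_rel : seq (M * N) -> seq (M * N) -> Prop :=
| tens_rel_refl s : tens_rel s s
| tens_rel_sym s t : tens_rel s t -> tens_rel t s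
| tens_rel_trans s t u : tens_rel s t -> tens_rel t u -> tens_rel s u
| tens_rel_cat s s' t t' :
    tens_rel s s' -> tens_rel t t' -> tens_rel (s ++ t) (s' ++ t')
| tens_rel_catC s t : tens_rel (s ++ t) (t ++ s)
| tens_rel_0l n : tens_rel [:: (0, n)] [::]
| tens_rel_0r m : tens_rel [:: (m, 0)] [::]
| tens_rel_Dl m m' n : tens_rel [:: (m + m', n)] [:: (m, n); (m', n)]
| tens_rel_Dr m n n' : tens_rel [:: (m, n + n')] [:: (m, n); (m, n')]
| tens_rel_Z c m n : tens_rel [:: (c *: m, n)] [:: (m, alg_in R c *: n)].

Definition tens_relb : rel (seq (M * N)) := fun s t => `[< tens_rel s t >].
Fact tens_relb_refl : reflexive tens_relb.
Proof. by move=> s; apply/asboolP/tens_rel_refl. Qed.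
Fact tens_relb_sym : symmetric tens_relb.
Proof. by move=> s t; apply/asboolP/asboolP; apply: tens_rel_sym. Qed.
Fact tens_relb_trans : transitive tens_relb.
Proof.
by move=> t s u /asboolP st /asboolP tu; apply/asboolP/(tens_rel_trans st tu).
Qed.
Canonical tens_equiv :=
  EquivRel tens_relb tens_relb_refl tens_relb_sym tens_relb_trans.

Definition tens : Type := {eq_quot tens_equiv}.

HB.instance Definition _ := Choice.copy tens {eq_quot tens_equiv}.

Definition tens_class (s : seq (M * N)) : tens := \pi_{eq_quot tens_equiv} s.
Definition tens_repr (x : tens) : seq (M * N) := repr (x : {eq_quot tens_equiv}).
Definition tensor (m : M) (n : N) : tens := tens_class [:: (m, n)].

Lemma tens_reprK x : tens_class (tens_repr x) = x.
Proof. exact: reprK. Qed.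
Lemma tens_classP s t : tens_rel s t <-> tens_class s = tens_class t.
Proof. by split=> [st|/eqquotP/asboolP//]; apply/eqquotP/asboolP. Qed.
Lemma repr_class s : tens_rel (tens_repr (tens_class s)) s.
Proof. by apply/tens_classP; rewrite tens_reprK. Qed.

Definition tens_zero := tens_class [::].
Definition tens_add x y := tens_class (tens_repr x ++ tens_repr y).
Lemma tens_addE s t :
  tens_add (tens_class s) (tens_class t) = tens_class (s ++ t).
Proof. by apply/tens_classP/tens_rel_cat; apply: repr_class. Qed.

Fact tens_addA : associative tens_add.
Proof.
move=> x y z; rewrite -[x]tens_reprK -[y]tens_reprK -[z]tens_reprK.
by rewrite !tens_addE catA.
Qed.
Fact tens_addC : commutative tens_add.
Proof. by move=> x y; apply/tens_classP/tens_rel_catC. Qed.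
Fact tens_add0 : left_id tens_zero tens_add.
Proof. by move=> x; rewrite -[x]tens_reprK tens_addE. Qed.

(* Termwise maps on formal sums descend to the tensor product when their
   values on pairs respect the relations. *)
Definition tens_compat (g : M * N -> tens) : Prop :=
  [/\ forall n, g (0, n) = tens_zero, forall m, g (m, 0) = tens_zero,
      forall m m' n, g (m + m', n) = tens_add (g (m, n)) (g (m', n)),
      forall m n n', g (m, n + n') = tens_add (g (m, n)) (g (m, n')) &
      forall c m n, g (c *: m, n) = g (m, alg_in R c *: n)].

Fact tens_compat_foldr g s t : tens_compat g -> tens_rel s t ->
  foldr (fun p => tens_add (g p)) tens_zero s =
  foldr (fun p => tens_add (g p)) tens_zero t.
Proof.
move=> [g0l g0r gDl gDr gZ].
have addx0 x : tens_add x tens_zero = x by rewrite tens_addC tens_add0.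
have cat_ s1 s2 : foldr (fun p => tens_add (g p)) tens_zero (s1 ++ s2) =
    tens_add (foldr (fun p => tens_add (g p)) tens_zero s1)
             (foldr (fun p => tens_add (g p)) tens_zero s2).
  by elim: s1 => [|p s1 IH] /=; rewrite ?tens_add0 // IH tens_addA.
elim=> {s t} //= [s t u _ -> _ -> //|s s' t t' _ IHs _ IHt|s t|n|m|||].
- by rewrite !cat_ IHs IHt.
- by rewrite !cat_ tens_addC.
- by rewrite g0l addx0.
- by rewrite g0r addx0.
- by move=> m m' n; rewrite gDl !addx0.
- by move=> m n n'; rewrite gDr !addx0.
- by move=> c m n; rewrite gZ.
Qed.

Definition tens_map (f : M * N -> M * N) (x : tens) : tens :=
  tens_class (map f (tens_repr x)).

Lemma tens_mapE f s : tens_compat (fun p => tens_class [:: f p]) ->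
  tens_map f (tens_class s) = tens_class (map f s).
Proof.
move=> cf; pose g p := tens_class [:: f p].
have gE t : foldr (fun p => tens_add (g p)) tens_zero t = tens_class (map f t).
  by elim: t => //= p t ->; rewrite tens_addE.
by rewrite /tens_map -!gE; apply: tens_compat_foldr cf (repr_class s).
Qed.

Definition tens_negp (p : M * N) : M * N := (- p.1, p.2).
Definition tens_opp := tens_map tens_negp.
Fact tens_negp_compat : tens_compat (fun p => tens_class [:: tens_negp p]).
Proof.
split=> *; rewrite /tens_negp ?tens_addE /=; apply/tens_classP.
- by rewrite oppr0; apply: tens_rel_0l.
- exact: tens_rel_0r.
- by rewrite opprD; apply: tens_rel_Dl.
- exact: tens_rel_Dr.
- by rewrite -scalerN; apply: tens_rel_Z.
Qed.
Fact tens_addN : left_inverse tens_zero tens_opp tens_add.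
Proof.
move=> x; rewrite -[x]tens_reprK /tens_opp (tens_mapE _ tens_negp_compat).
rewrite tens_addE; elim: (tens_repr x) => // p s IH.
rewrite -tens_addE in IH.
rewrite map_cons -(cat1s (tens_negp p)) -(cat1s p) -!tens_addE.
set X := tens_class (map _ _) in IH *; set S := tens_class s in IH *.
set Q := tens_class [:: p]; rewrite -tens_addA (tens_addA X) [tens_add X Q]tens_addC.
rewrite -(tens_addA Q) IH [tens_add Q _]tens_addC tens_add0 tens_addE.
apply/tens_classP.
rewrite [p]surjective_pairing /tens_negp /=.
apply: tens_rel_trans (tens_rel_0l p.2); rewrite -(addNr p.1).
exact/tens_rel_sym/tens_rel_Dl.
Qed.

HB.instance Definition _ :=
  GRing.isZmodule.Build tens tens_addA tens_addC tens_add0 tens_addN.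

Lemma tens_classE s : tens_class s = \sum_(p <- s) tensor p.1 p.2.
Proof.
elim: s => [|[m n] s IH]; first by rewrite big_nil.
by rewrite big_cons -IH -cat1s -tens_addE.
Qed.

Lemma tensorDl m m' n : tensor (m + m') n = tensor m n + tensor m' n.
Proof. by rewrite [RHS]tens_addE; apply/tens_classP/tens_rel_Dl. Qed.
Lemma tensorDr m n n' : tensor m (n + n') = tensor m n + tensor m n'.
Proof. by rewrite [RHS]tens_addE; apply/tens_classP/tens_rel_Dr. Qed.
Lemma tensorZ c m n : tensor (c *: m) n = tensor m (alg_in R c *: n).
Proof. exact/tens_classP/tens_rel_Z. Qed.

Lemma tens_ind (Q : tens -> Prop) : Q 0 -> (forall x y, Q x -> Q y -> Q (x + y)) ->
  (forall m n, Q (tensor m n)) -> forall x, Q x.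
Proof.
move=> Q0 QD Qt x; rewrite -[x]tens_reprK tens_classE.
by elim/big_ind: _ => // p _; apply: Qt.
Qed.

Definition balanced (G : zmodType) (f : M -> N -> G) : Prop :=
  [/\ forall m m' n, f (m + m') n = f m n + f m' n,
      forall m n n', f m (n + n') = f m n + f m n' &
      forall c m n, f (c *: m) n = f m (alg_in R c *: n)].

Definition tens_lift (G : zmodType) (f : M -> N -> G) (x : tens) : G :=
  \sum_(p <- tens_repr x) f p.1 p.2.

Section Lift.
Variables (G : zmodType) (f : M -> N -> G).
Hypothesis f_bal : balanced f.

Lemma tens_lift_class s : tens_lift f (tens_class s) = \sum_(p <- s) f p.1 p.2.
Proof.
case: f_bal => fDl fDr fZ; rewrite /tens_lift.
move: (tens_repr _) (repr_class s) => r; elim => {r s} //= [s t u _ -> _ -> //|s s' t t' _ IHs _ IHt|s t|n|m|||].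
- by rewrite !big_cat /= IHs IHt.
- by rewrite !big_cat /= addrC.
- by rewrite big_seq1 big_nil /=; apply: (addIr (f 0 n)); rewrite -fDl !add0r.
- by rewrite big_seq1 big_nil /=; apply: (addIr (f m 0)); rewrite -fDr !add0r.
- by move=> m m' n; rewrite !big_cons !big_nil !addr0 /= fDl.
- by move=> m n n'; rewrite !big_cons !big_nil !addr0 /= fDr.
- by move=> c m n; rewrite !big_seq1 /= fZ.
Qed.

Lemma tens_liftE m n : tens_lift f (tensor m n) = f m n.
Proof. by rewrite tens_lift_class big_seq1. Qed.

Lemma tens_liftD : {morph tens_lift f : x y / x + y}.
Proof.
move=> x y; rewrite -[x]tens_reprK -[y]tens_reprK [_ + _]tens_addE.
by rewrite !tens_lift_class big_cat.
Qed.

Lemma tens_lift0 : tens_lift f 0 = 0.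
Proof. by rewrite [0]/(tens_class [::]) tens_lift_class big_nil. Qed.

Lemma tens_lift_uniq (g : tens -> G) : {morph g : x y / x + y} ->
  (forall m n, g (tensor m n) = f m n) -> g =1 tens_lift f.
Proof.
move=> gD gE; apply: tens_ind => [|x y Ex Ey|m n].
- by rewrite tens_lift0; apply: (addIr (g 0)); rewrite -gD !add0r.
- by rewrite gD tens_liftD Ex Ey.
- by rewrite gE tens_liftE.
Qed.

End Lift.

Definition tens_scalep (a : R) (p : M * N) : M * N := (p.1, a *: p.2).
Definition tens_scale a := tens_map (tens_scalep a).
Fact tens_scalep_compat a :
  tens_compat (fun p => tens_class [:: tens_scalep a p]).
Proof.
split=> *; rewrite /tens_scalep ?tens_addE /=; apply/tens_classP.
- exact: tens_rel_0l.
- by rewrite scaler0; apply: tens_rel_0r.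
- exact: tens_rel_Dl.
- by rewrite scalerDr; apply: tens_rel_Dr.
- by rewrite scalerA -alg_inC -scalerA; apply: tens_rel_Z.
Qed.
Lemma tens_scaleE a m n : tens_scale a (tensor m n) = tensor m (a *: n).
Proof. exact: (tens_mapE _ (tens_scalep_compat a)). Qed.
Fact tens_scaleDr : right_distributive tens_scale +%R.
Proof.
move=> a x y; rewrite -[x]tens_reprK -[y]tens_reprK.
rewrite [X in tens_scale _ X]tens_addE /tens_scale.
by rewrite !(tens_mapE _ (tens_scalep_compat a)) map_cat -tens_addE.
Qed.
Fact tens_scale0 a : tens_scale a 0 = 0.
Proof. by apply: (addIr (tens_scale a 0)); rewrite -tens_scaleDr !add0r. Qed.
Fact tens_scaleA a b x : tens_scale a (tens_scale b x) = tens_scale (a * b) x.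
Proof.
elim/tens_ind: x => [|x y Ex Ey|m n]; first by rewrite !tens_scale0.
  by rewrite !tens_scaleDr Ex Ey.
by rewrite !tens_scaleE scalerA.
Qed.
Fact tens_scale1 : left_id 1 tens_scale.
Proof.
elim/tens_ind => [|x y Ex Ey|m n]; first by rewrite tens_scale0.
  by rewrite tens_scaleDr Ex Ey.
by rewrite tens_scaleE scale1r.
Qed.
Fact tens_scaleDl x : {morph tens_scale^~ x : a b / a + b}.
Proof.
move=> a b; elim/tens_ind: x => [|x y Ex Ey|m n].
- by rewrite !tens_scale0 addr0.
- by rewrite !tens_scaleDr Ex Ey addrACA.
- by rewrite !tens_scaleE scalerDl tensorDr.
Qed.

HB.instance Definition _ := GRing.Zmodule_isLmodule.Build R tens
  tens_scaleA tens_scale1 tens_scaleDr tens_scaleDl.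

Lemma tensorZr a m n : a *: tensor m n = tensor m (a *: n).
Proof. exact: tens_scaleE. Qed.

End Tensor.

Definition tens_alg_type (C : comPzRingType) (A B : algebra C) : Type :=
  tens (alg_mod A) (B^o : lmodType B).

Section TensorAlgebra.
Variables (C : comPzRingType) (A B : algebra C).

HB.instance Definition _ := GRing.Zmodule.copy (tens_alg_type A B)
  (tens (alg_mod A) (B^o : lmodType B)).

Definition tensa (a : A) (b : B) : tens_alg_type A B :=
  tensor (a : alg_mod A) (b : B^o).

(* (a (x) b) (a' (x) b') = aa' (x) bb' *)
Definition tensa_mul (x y : tens_alg_type A B) : tens_alg_type A B :=
  tens_lift (fun (a : alg_mod A) (b : B^o) =>
    tens_lift (fun (a' : alg_mod A) (b' : B^o) =>
      tensa ((a : A) * (a' : A)) ((b : B) * (b' : B))) y) x.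

Lemma tensaDl a a' b : tensa (a + a') b = tensa a b + tensa a' b.
Proof. exact: tensorDl. Qed.
Lemma tensaDr a b b' : tensa a (b + b') = tensa a b + tensa a b'.
Proof. exact: tensorDr. Qed.
Lemma tensaZ c a b : tensa (alg_in A c * a) b = tensa a (alg_in B c * b).
Proof. exact: (tensorZ c (a : alg_mod A) (b : B^o)). Qed.

Lemma tensa_ind (Q : tens_alg_type A B -> Prop) :
  Q 0 -> (forall x y, Q x -> Q y -> Q (x + y)) ->
  (forall a b, Q (tensa a b)) -> forall x, Q x.
Proof. by move=> Q0 QD Qt; apply: tens_ind => // m n; apply: Qt. Qed.

Fact tensa_bal_r a b :
  balanced (fun (a' : alg_mod A) (b' : B^o) =>
    tensa ((a : A) * (a' : A)) ((b : B) * (b' : B))).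
Proof.
split=> [a1 a2 b1|a1 b1 b2|c a1 b1].
- by rewrite mulrDr tensaDl.
- by rewrite mulrDr tensaDr.
- rewrite [(c *: a1 : A)]/(alg_in A c * (a1 : A)).
  rewrite [(alg_in B c *: b1 : B)]/(alg_in B c * (b1 : B)).
  by rewrite !mulrA -!alg_inC -!mulrA tensaZ.
Qed.

Fact tensa_bal_l y :
  balanced (fun (a : alg_mod A) (b : B^o) =>
    tens_lift (fun (a' : alg_mod A) (b' : B^o) =>
      tensa ((a : A) * (a' : A)) ((b : B) * (b' : B))) y).
Proof.
split=> [a1 a2 b1|a1 b1 b2|c a1 b1]; rewrite /tens_lift -?big_split /=;
  apply: eq_bigr => -[a' b'] _ /=.
- by rewrite mulrDl tensaDl.
- by rewrite mulrDl tensaDr.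
- rewrite [(c *: a1 : A)]/(alg_in A c * (a1 : A)).
  rewrite [(alg_in B c *: b1 : B)]/(alg_in B c * (b1 : B)).
  by rewrite -!mulrA tensaZ.
Qed.

Lemma tensa_mulE a b a' b' :
  tensa_mul (tensa a b) (tensa a' b') = tensa (a * a') (b * b').
Proof.
by rewrite /tensa_mul (tens_liftE (tensa_bal_l _)) (tens_liftE (tensa_bal_r _ _)).
Qed.

Fact tensa_mulDl : left_distributive tensa_mul +%R.
Proof. by move=> x y z; rewrite /tensa_mul (tens_liftD (tensa_bal_l _)). Qed.
Fact tensa_mulDr : right_distributive tensa_mul +%R.
Proof.
move=> x y z; rewrite /tensa_mul {1 3 5}/tens_lift -big_split /=.
by apply: eq_bigr => -[a b] _; rewrite (tens_liftD (tensa_bal_r _ _)).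
Qed.
Fact tensa_mul0l y : tensa_mul 0 y = 0.
Proof. by apply: (addIr (tensa_mul 0 y)); rewrite -tensa_mulDl !add0r. Qed.
Fact tensa_mul0r x : tensa_mul x 0 = 0.
Proof. by apply: (addIr (tensa_mul x 0)); rewrite -tensa_mulDr !add0r. Qed.
Fact tensa_mulA : associative tensa_mul.
Proof.
elim/tensa_ind=> [y z|x1 x2 E1 E2 y z|a b]; first by rewrite !tensa_mul0l.
  by rewrite !tensa_mulDl E1 E2.
elim/tensa_ind=> [z|y1 y2 E1 E2 z|a' b'].
- by rewrite tensa_mul0l tensa_mul0r tensa_mul0l.
- by rewrite tensa_mulDl !tensa_mulDr tensa_mulDl E1 E2.
elim/tensa_ind=> [|z1 z2 E1 E2|a'' b'']; first by rewrite !tensa_mul0r.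
  by rewrite !tensa_mulDr E1 E2.
by rewrite !tensa_mulE !mulrA.
Qed.
Fact tensa_mul1l : left_id (tensa 1 1) tensa_mul.
Proof.
elim/tensa_ind=> [|x y Ex Ey|a b]; first exact: tensa_mul0r.
  by rewrite tensa_mulDr Ex Ey.
by rewrite tensa_mulE !mul1r.
Qed.
Fact tensa_mul1r : right_id (tensa 1 1) tensa_mul.
Proof.
elim/tensa_ind=> [|x y Ex Ey|a b]; first exact: tensa_mul0l.
  by rewrite tensa_mulDl Ex Ey.
by rewrite tensa_mulE !mulr1.
Qed.

HB.instance Definition _ := GRing.Zmodule_isPzRing.Build (tens_alg_type A B)
  tensa_mulA tensa_mul1l tensa_mul1r tensa_mulDl tensa_mulDr.

Definition tensa_in (c : C) : tens_alg_type A B := tensa (alg_in A c) 1.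
Fact tensa_in_zmod : zmod_morphism tensa_in.
Proof.
move=> c d; apply: (addIr (tensa_in d)).
by rewrite subrK -[LHS]tensaDl -rmorphD subrK.
Qed.
Fact tensa_in_monoid : monoid_morphism tensa_in.
Proof.
split=> [|c d]; first by rewrite /tensa_in rmorph1.
by rewrite [RHS]tensa_mulE mulr1 -rmorphM.
Qed.
HB.instance Definition _ :=
  GRing.isZmodMorphism.Build C (tens_alg_type A B) tensa_in tensa_in_zmod.
HB.instance Definition _ :=
  GRing.isMonoidMorphism.Build C (tens_alg_type A B) tensa_in tensa_in_monoid.
Fact tensa_inC c (x : tens_alg_type A B) : tensa_in c * x = x * tensa_in c.
Proof.
elim/tensa_ind: x => [|x y Ex Ey|a b]; first by rewrite mulr0 mul0r.
  by rewrite mulrDr mulrDl Ex Ey.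
by rewrite [LHS]tensa_mulE [RHS]tensa_mulE alg_inC mulr1 mul1r.
Qed.

Definition tens_alg : algebra C :=
  @Algebra C (tens_alg_type A B) tensa_in tensa_inC.

End TensorAlgebra.

Section Progenerators.
Variables (R : pzRingType) (M : lmodType R).

Definition fin_generated : Prop :=
  exists n (x : 'I_n -> M), forall m, exists a : 'I_n -> R,
    m = \sum_i a i *: x i.

Definition projective : Prop :=
  forall (X Y : lmodType R) (g : {linear X -> Y}) (f : {linear M -> Y}),
    (forall y, exists x, g x = y) ->
    exists h : {linear M -> X}, forall m, g (h m) = f m.

(* The functor Hom_R(M, -) is faithful. *)
Definition generator : Prop :=
  forall (X Y : lmodType R) (f g : {linear X -> Y}),
    (forall (h : {linear M -> X}) m, f (h m) = g (h m)) -> f =1 g.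

Definition progenerator : Prop := [/\ fin_generated, projective & generator].

End Progenerators.

Definition mod_isomorphic (R : pzRingType) (M N : lmodType R) : Prop :=
  exists f : {linear M -> N}, bijective f.

Section Azumaya.
Variable C : comPzRingType.

Definition azumaya (A : algebra C) : Prop :=
  progenerator (alg_mod A) /\
  exists2 phi : {rmorphism tens_alg A (op_alg A) ->
                           end_alg (A := base_alg C) (alg_mod A)},
    alg_iso phi &
    forall (a b x : A), (phi (tensa a (b : op_alg A)) : endo _) x = a * x * b.

Definition brauer_equiv (A B : algebra C) : Prop :=
  exists P Q : lmodType C,
    [/\ progenerator P, progenerator Q &
        alg_isomorphic (tens_alg A (end_alg (A := base_alg C) P))
                       (tens_alg B (end_alg (A := base_alg C) Q))].

End Azumaya.

Record prime_ideal (C : comPzRingType) := PrimeIdeal {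
  prime_set :> {pred C};
  prime0 : 0 \in prime_set;
  primeD : forall x y, x \in prime_set -> y \in prime_set -> x + y \in prime_set;
  primeM : forall x y, y \in prime_set -> x * y \in prime_set;
  prime1N : 1 \notin prime_set;
  primeMI : forall x y, x * y \in prime_set ->
    (x \in prime_set) || (y \in prime_set)
}.

Section Localization.
Variables (C : comPzRingType) (p : prime_ideal C) (M : lmodType C).

Notation denom := {s : C | s \notin p}.

(* Fractions m / s with s outside p. *)
Definition loc_rel : rel (M * denom) := fun x y =>
  `[< exists2 u : C, u \notin p &
      u *: (val y.2 *: x.1) = u *: (val x.2 *: y.1) >].

Fact denomM_subproof (s t : denom) : val s * val t \notin p.
Proof.
by apply/negP=> /primeMI; rewrite (negPf (valP s)) (negPf (valP t)).
Qed.
Definition denomM (s t : denom) : denom := exist (fun s => s \notin p) _ (denomM_subproof s t).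
Definition denom1 : denom := exist (fun s => s \notin p) _ (prime1N p).

Fact loc_rel_refl : reflexive loc_rel.
Proof. by move=> x; apply/asboolP; exists 1; first exact: prime1N. Qed.
Fact loc_rel_sym : symmetric loc_rel.
Proof. by move=> x y; apply/asboolP/asboolP=> -[u pu E]; exists u. Qed.
Fact loc_rel_trans : transitive loc_rel.
Proof.
move=> y x z /asboolP[u pu Exy] /asboolP[v pv Eyz]; apply/asboolP.
pose w := denomM y.2 (denomM (exist _ u pu) (exist _ v pv)).
exists (val w); first exact: (valP w).
rewrite /= in Exy Eyz *; move: (val x.2) (val y.2) (val z.2) Exy Eyz => r s t.
move=> Exy Eyz; transitivity ((v * t) *: (u *: (s *: x.1))).
  by rewrite !scalerA; congr (_ *: _); ring.
rewrite Exy; transitivity ((u * r) *: (v *: (t *: y.1))).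
  by rewrite !scalerA; congr (_ *: _); ring.
by rewrite Eyz !scalerA; congr (_ *: _); ring.
Qed.
Canonical loc_equiv := EquivRel loc_rel loc_rel_refl loc_rel_sym loc_rel_trans.

Definition loc : Type := {eq_quot loc_equiv}.
HB.instance Definition _ := Choice.copy loc {eq_quot loc_equiv}.

Definition frac_of (x : M * denom) : loc := \pi_{eq_quot loc_equiv} x.
Definition loc_repr (x : loc) : M * denom := repr (x : {eq_quot loc_equiv}).
Definition locf (m : M) (s : denom) : loc := frac_of (m, s).

Lemma loc_reprK x : locf (loc_repr x).1 (loc_repr x).2 = x.
Proof. by rewrite /locf -surjective_pairing; apply: reprK. Qed.
Lemma locfP m s n t : locf m s = locf n t <->
  exists2 u : C, u \notin p & u *: (val t *: m) = u *: (val s *: n).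
Proof. by split=> [/eqquotP/asboolP|?]; last exact/eqquotP/asboolP. Qed.
Lemma loc_reprP m s : exists2 u : C, u \notin p &
  u *: (val s *: (loc_repr (locf m s)).1)
    = u *: (val (loc_repr (locf m s)).2 *: m).
Proof. by apply/locfP; rewrite loc_reprK. Qed.

Definition loc_zero := locf 0 denom1.
Definition loc_opp (x : loc) := locf (- (loc_repr x).1) (loc_repr x).2.
Definition loc_add (x y : loc) := let: (m, s) := loc_repr x in
  let: (n, t) := loc_repr y in locf (val t *: m + val s *: n) (denomM s t).
Definition loc_scale (c : C) (x : loc) :=
  locf (c *: (loc_repr x).1) (loc_repr x).2.

Lemma loc_oppE m s : loc_opp (locf m s) = locf (- m) s.
Proof.
have [u pu E] := loc_reprP m s; apply/locfP; exists u => //.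
by rewrite !scalerN E.
Qed.
Lemma loc_scaleE c m s : loc_scale c (locf m s) = locf (c *: m) s.
Proof.
have [u pu E] := loc_reprP m s; apply/locfP; exists u => //.
have swap (a b : C) (n : M) : u *: (a *: (b *: n)) = b *: (u *: (a *: n)).
  by rewrite !scalerA; congr (_ *: _); ring.
by rewrite !swap E.
Qed.
Lemma loc_addE m s n t :
  loc_add (locf m s) (locf n t) = locf (val t *: m + val s *: n) (denomM s t).
Proof.
rewrite /loc_add; have := loc_reprP m s; have := loc_reprP n t.
case: (loc_repr (locf m s)) (loc_repr (locf n t)) => [m1 s1] [n1 t1] /=.
move=> [v pv Ev] [u pu Eu]; apply/locfP.
exists (u * v); first exact: (denomM_subproof (exist _ u pu) (exist _ v pv)).
rewrite /= !scalerDr; congr (_ + _).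
  transitivity ((v * sval t * sval t1) *: (u *: (sval s *: m1))).
    by rewrite !scalerA; congr (_ *: _); ring.
  by rewrite Eu !scalerA; congr (_ *: _); ring.
transitivity ((u * sval s * sval s1) *: (v *: (sval t *: n1))).
  by rewrite !scalerA; congr (_ *: _); ring.
by rewrite Ev !scalerA; congr (_ *: _); ring.
Qed.

Lemma loc_eq m s n t : val t *: m = val s *: n -> locf m s = locf n t.
Proof. by move=> E; apply/locfP; exists 1; rewrite ?prime1N ?E. Qed.

Fact loc_addA : associative loc_add.
Proof.
move=> x y z; rewrite -[x]loc_reprK -[y]loc_reprK -[z]loc_reprK !loc_addE.
by apply: loc_eq; rewrite /= !scalerDr !scalerA addrA; congr (_ + _ + _);
  congr (_ *: _); ring.
Qed.
Fact loc_addC : commutative loc_add.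
Proof.
move=> x y; rewrite -[x]loc_reprK -[y]loc_reprK !loc_addE.
by apply: loc_eq; rewrite /= addrC mulrC.
Qed.
Fact loc_add0 : left_id loc_zero loc_add.
Proof.
move=> x; rewrite -[x]loc_reprK loc_addE.
by apply: loc_eq; rewrite /= scaler0 add0r scale1r mul1r.
Qed.
Fact loc_addN : left_inverse loc_zero loc_opp loc_add.
Proof.
move=> x; rewrite -[x]loc_reprK loc_oppE loc_addE.
by apply: loc_eq; rewrite /= scalerN addNr !scaler0.
Qed.
HB.instance Definition _ :=
  GRing.isZmodule.Build loc loc_addA loc_addC loc_add0 loc_addN.

Fact loc_scaleA a b x : loc_scale a (loc_scale b x) = loc_scale (a * b) x.
Proof. by rewrite -[x]loc_reprK !loc_scaleE scalerA. Qed.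
Fact loc_scale1 : left_id 1 loc_scale.
Proof. by move=> x; rewrite -[x]loc_reprK loc_scaleE scale1r. Qed.
Fact loc_scaleDr : right_distributive loc_scale +%R.
Proof.
move=> a x y; rewrite -[x]loc_reprK -[y]loc_reprK.
rewrite [X in loc_scale _ X]loc_addE !loc_scaleE [RHS]loc_addE.
by apply: loc_eq; congr (_ *: _); rewrite scalerDr !scalerA ![a * _]mulrC.
Qed.
Fact loc_scaleDl x : {morph loc_scale^~ x : a b / a + b}.
Proof.
move=> a b; rewrite -[x]loc_reprK !loc_scaleE [RHS]loc_addE.
by apply: loc_eq; rewrite /= -scalerDr -scalerDl -scalerA.
Qed.
HB.instance Definition _ := GRing.Zmodule_isLmodule.Build C loc
  loc_scaleA loc_scale1 loc_scaleDr loc_scaleDl.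

End Localization.

(* I_p is isomorphic to C_p for every prime p. A C-linear map between
   localizations at p is C_p-linear, because the elements outside p act
   invertibly; so it is enough to ask for an isomorphism of C-modules. *)
Definition rank_one_projective (C : comPzRingType) (I : lmodType C) : Prop :=
  [/\ fin_generated I, projective I &
      forall p : prime_ideal C,
        mod_isomorphic (loc p I) (loc p (C^o : lmodType C))].

(* An (S, R)-bimodule: a right R-module with a ring morphism from S to its
   ring of R-endomorphisms. *)
Record bimodule (S R : pzRingType) := Bimodule {
  bimod_right :> lmodType R^c;
  bimod_left : {rmorphism S -> endo bimod_right}
}.

Definition lact (S R : pzRingType) (K : bimodule S R) (s : S) (k : K) : K :=
  (bimod_left K s : endo K) k.

Definition ract (S R : pzRingType) (K : bimodule S R) (k : K) (r : R) : K :=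
  (r : R^c) *: k.

Definition bimod_progenerator (S R : pzRingType) (K : bimodule S R) : Prop :=
  progenerator (bimod_right K) /\
  forall f : {linear K -> K}, exists! s : S, forall k : K, f k = lact s k.

Definition has_type (C : comPzRingType) (S R : algebra C) (K : bimodule S R)
    (tau : C -> C) : Prop :=
  forall (c : C) (k : K), lact (alg_in S (tau c)) k = ract k (alg_in R c).

(* Hom_R(P, K) for a right R-module P and an (S, R)-bimodule K; it is a left
   S-module via (s f) p = s (f p). *)
Definition bihom (S R : pzRingType) (P : lmodType R^c) (K : bimodule S R) : Type :=
  hom P (bimod_right K).
Definition bihom_fun S R P K (f : @bihom S R P K) : hom P (bimod_right K) := f.
Coercion bihom_fun : bihom >-> hom.

Section BimoduleHom.
Variables (S R : pzRingType) (P : lmodType R^c) (K : bimodule S R).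

HB.instance Definition _ :=
  GRing.Zmodule.copy (bihom P K) (hom P (bimod_right K)).

Fact bihom_scale_lin (s : S) (f : bihom P K) :
  linear (fun p => lact s (f p)).
Proof. by move=> a u v; rewrite /lact !linearP. Qed.
Definition bihom_scale s f : bihom P K := mk_linear (bihom_scale_lin s f).
Fact bihom_scaleA s t f :
  bihom_scale s (bihom_scale t f) = bihom_scale (s * t) f.
Proof. by apply: linear_ext => u /=; rewrite /lact rmorphM. Qed.
Fact bihom_scale1 : left_id 1 bihom_scale.
Proof. by move=> f; apply: linear_ext => u /=; rewrite /lact rmorph1. Qed.
Fact bihom_scaleDr : right_distributive bihom_scale +%R.
Proof. by move=> s f g; apply: linear_ext => u /=; rewrite /lact linearD. Qed.
Fact bihom_scaleDl f : {morph bihom_scale^~ f : s t / s + t}.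
Proof. by move=> s t; apply: linear_ext => u /=; rewrite /lact rmorphD. Qed.
HB.instance Definition _ := GRing.Zmodule_isLmodule.Build S (bihom P K)
  bihom_scaleA bihom_scale1 bihom_scaleDr bihom_scaleDl.

End BimoduleHom.

(* P^[1]: K is an (A^op, A^sigma)-bimodule, [ract] is the right A-action
   k (.)_0 a, and [lact] by A^op is the right A-action k (.)_1 a = a^op k.
   So Hom_A(P, K_0), with its left A^op-module structure, is the right
   A-module with (f a) p = f p (.)_1 a. *)
Definition dual1 (C : comPzRingType) (sigma : {rmorphism C -> C})
    (A : algebra C) (K : bimodule (op_alg A) (twist_alg A sigma))
    (P : lmodType (op_alg A)) : lmodType (op_alg A) :=
  bihom (P : lmodType (twist_alg A sigma)^c) K.

Definition has_anti_automorphism (C : comPzRingType) (B : algebra C)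
    (sigma : C -> C) : Prop :=
  exists alpha : {rmorphism B -> B^c},
    bijective alpha /\ forall c, alpha (alg_in B c) = alg_in B (sigma c).

(* Main.v *)
From HB Require Import structures.
Require Import Defs.
From mathcomp Require Import all_boot all_order all_algebra.
From mathcomp Require Import boolp classical_sets ring.
Set Implicit Arguments.
Unset Strict Implicit.
Unset Printing Implicit Defensive.
Import GRing.Theory.
Local Open Scope ring_scope.
Local Open Scope quotient_scope.

(* Write B = End_A(P) and B1 = End_A(P^[1]). Since K is a progenerator with
   A^op = End_A(K), precomposition b |-> (f |-> f b) is a ring anti-isomorphism
   from B onto B1, and it sends sigma(c) to c; composing with it turns
   anti-automorphisms of B of type sigma into C-algebra isomorphisms B -> B1.
   If I is invertible, b |-> 1 (x) b is an isomorphism from End_A(P) onto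
   End_A(I (x) P). Conversely, an isomorphism psi : End_A(P) -> End_A(Q) gives
   the C-module I of A-linear maps h : P -> Q with h b = psi(b) h, and
   evaluation I (x) P -> Q is bijective: for a C-linear form g on A, the Azumaya
   property provides an element sum u (x) v of A (x) A with sum u x v = g(x),
   and h |-> sum h(- u) v averages B-linear maps P -> Q into I. Then I is a
   direct summand of a power of Q over C, it generates C, and h |-> f(h) x on I
   induces a central endomorphism of Q, hence is a scalar; this forces I to have
   rank one at every prime. Everything is expressed by dual bases
   m = sum f_j(m) x_j and trace identities sum f_j(x_j) = 1. *)

(** * Dual bases and trace identities *)

Section QuotientModule.
Variables (R : pzRingType) (M : lmodType R) (S : M -> Prop).
Hypotheses (S0 : S 0) (SP : forall a x y, S x -> S y -> S (a *: x + y)).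

Definition quo_rel : rel M := fun x y => `[< S (x - y) >].

Let SN x : S x -> S (- x).
Proof. by move=> Sx; rewrite -[- x]addr0 -scaleN1r; apply: SP. Qed.

Fact quo_rel_refl : reflexive quo_rel.
Proof. by move=> x; apply/asboolP; rewrite subrr. Qed.
Fact quo_rel_sym : symmetric quo_rel.
Proof. by move=> x y; apply/asboolP/asboolP => /SN; rewrite opprB. Qed.
Fact quo_rel_trans : transitive quo_rel.
Proof.
move=> y x z /asboolP Sxy /asboolP Syz; apply/asboolP.
by rewrite -(subrK y x) -addrA -[x - y]scale1r; apply: SP.
Qed.

Let quo_equiv := EquivRel quo_rel quo_rel_refl quo_rel_sym quo_rel_trans.

(** Provides the quotient of a ring by a trace ideal, the test object for generators. The subset [S]
    is a submodule by [S0] and [SP], and the operations are computed on representatives. *)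
Lemma quotient_module : exists (Q : lmodType R) (pi : {linear M -> Q}),
  forall x, pi x = 0 <-> S x.
Proof.
pose Q := {eq_quot quo_equiv}; pose cl (x : M) : Q := \pi_Q x.
have clP x y : cl x = cl y <-> S (x - y).
  by split=> [/eqquotP/asboolP|?] //; apply/eqquotP/asboolP.
have reprK (q : Q) : cl (repr q) = q by exact: reprK.
have reprS x : S (repr (cl x) - x) by apply/clP; rewrite reprK.
pose add (p q : Q) := cl (repr p + repr q).
pose opp (p : Q) := cl (- repr p).
pose scale a (p : Q) := cl (a *: repr p).
have SD x y : S x -> S y -> S (x + y).
  by move=> Sx Sy; rewrite -[x]scale1r; apply: SP.
have SZ a x : S x -> S (a *: x).
  by move=> Sx; rewrite -[_ *: _]addr0; apply: SP.
have addE x y : add (cl x) (cl y) = cl (x + y).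
  by apply/clP; rewrite opprD addrACA; apply: SD.
have oppE x : opp (cl x) = cl (- x).
  by apply/clP; rewrite -opprD; apply: SN.
have scaleE a x : scale a (cl x) = cl (a *: x).
  by apply/clP; rewrite -scalerBr; apply: SZ.
have addA : associative add.
  by move=> x y z; rewrite -[x]reprK -[y]reprK -[z]reprK !addE addrA.
have addC : commutative add.
  by move=> x y; rewrite -[x]reprK -[y]reprK !addE addrC.
have add0 : left_id (cl 0) add by move=> x; rewrite -[x]reprK addE add0r.
have addN : left_inverse (cl 0) opp add.
  by move=> x; rewrite -[x]reprK oppE addE addNr.
pose zm := GRing.isZmodule.Build Q addA addC add0 addN.
pose QZ : zmodType := HB.pack Q zm.
have scaleA a b (x : QZ) : scale a (scale b x) = scale (a * b) x.
  by rewrite -[x]reprK !scaleE scalerA.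
have scale1 : left_id 1 (scale : R -> QZ -> QZ).
  by move=> x; rewrite -[x]reprK scaleE scale1r.
have scaleDr : right_distributive (scale : R -> QZ -> QZ) +%R.
  move=> a x y; rewrite -[x]reprK -[y]reprK [X in scale _ X]addE !scaleE.
  by rewrite [RHS]addE scalerDr.
have scaleDl (x : QZ) : {morph (scale : R -> QZ -> QZ)^~ x : a b / a + b}.
  by move=> a b; rewrite -[x]reprK !scaleE [RHS]addE scalerDl.
pose lm := GRing.Zmodule_isLmodule.Build R QZ scaleA scale1 scaleDr scaleDl.
pose QL : lmodType R := HB.pack QZ lm.
have cl_lin : linear (cl : M -> QL).
  by move=> a x y; rewrite -[LHS]addE -scaleE.
exists QL, (mk_linear cl_lin) => x /=.
by split=> [/clP|Sx]; [|apply/clP]; rewrite subr0.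
Qed.

End QuotientModule.

Section DualBases.
Variables (R : pzRingType) (M : lmodType R).

(** The index set is any finite type, so a product of two dual bases needs no renumbering. *)
Definition has_dual_basis : Prop :=
  exists (J : finType) (x : J -> M) (f : J -> {linear M -> R^o}),
    forall m, m = \sum_j (f j m : R) *: x j.

Definition has_trace_one : Prop :=
  exists (J : finType) (x : J -> M) (f : J -> {linear M -> R^o}),
    \sum_j f j (x j) = 1.

Lemma dual_basisP : has_dual_basis <-> fin_generated M /\ projective M.
Proof.
split=> [[J [x [f fx]]]|[[n [x xgen]] Mproj]].
  split.
    exists #|J|, (x \o enum_val) => m; exists (fun i => f (enum_val i) m).
    by rewrite {1}[m]fx (reindex_onto enum_val enum_rank) /= => [|j _];
      rewrite ?enum_rankK //; apply: eq_bigl => i; rewrite enum_valK eqxx.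
  move=> X Y g h gsurj; have /choice[s sP] j := gsurj (h (x j)).
  have hl : linear (fun m => \sum_j (f j m : R) *: s j).
    move=> a u v; rewrite scaler_sumr -big_split; apply: eq_bigr => j _ /=.
    by rewrite linearP scalerDl scalerA.
  exists (mk_linear hl) => m /=; rewrite linear_sum {2}[m]fx linear_sum.
  by apply: eq_bigr => j _; rewrite !linearZ /= sP.
pose X : lmodType R := {ffun 'I_n -> R^o}.
have gl : linear (fun a : X => \sum_i (a i : R) *: x i : M).
  move=> a u v; rewrite scaler_sumr -big_split; apply: eq_bigr => j _ /=.
  by rewrite !ffunE scalerDl scalerA.
(* A splitting of the free cover; its coordinates are the dual forms. *)
have [|h hP] := Mproj X M (mk_linear gl) (endo_one M).
  move=> m; have [a ->] := xgen m; exists [ffun i => a i] => /=.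
  by apply: eq_bigr => i _; rewrite ffunE.
have fl i : linear (fun m => h m i : R^o).
  by move=> a u v; rewrite linearP !ffunE.
by exists 'I_n, x, (fun i => mk_linear (fl i)) => m /=; rewrite -[LHS]hP.
Qed.

Definition trace_ideal (a : R^o) : Prop :=
  exists s : seq (M * {linear M -> R^o}), a = \sum_(p <- s) p.2 p.1.

Lemma trace_idealD a b : trace_ideal a -> trace_ideal b -> trace_ideal (a + b).
Proof. by move=> [s ->] [t ->]; exists (s ++ t); rewrite big_cat. Qed.

Lemma trace_ideal_one : trace_ideal 1 -> has_trace_one.
Proof.
move=> [s s1]; exists 'I_(size s), (fun i => (tnth (in_tuple s) i).1),
  (fun i => (tnth (in_tuple s) i).2).
by rewrite s1 [RHS](big_tnth _ _ s).
Qed.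

(** The projection of [R] onto its quotient by the trace ideal agrees with the zero map after
    composition with every map from [M]. Hence both are equal, and 1 lies in the trace ideal. *)
Lemma generator_trace_one : generator M -> has_trace_one.
Proof.
move=> Mgen; have [|a u v [s ->] [t ->]|Q [pi piP]] :=
    @quotient_module R R^o trace_ideal.
- by exists [::]; rewrite big_nil.
- exists ([seq (a *: p.1, p.2) | p <- s] ++ t).
  rewrite big_cat big_map scaler_sumr; congr (_ + _).
  by apply: eq_bigr => p _ /=; rewrite linearZ.
have zl : linear (fun _ : R^o => 0 : Q) 
  by move=> a u v /=; rewrite scaler0 addr0.
have pi0 : pi =1 mk_linear zl.
  apply: Mgen => h m /=; apply/piP; exists [:: (m, h)].
  by rewrite big_seq1.
by apply: trace_ideal_one; apply/piP; apply: pi0.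
Qed.

End DualBases.

(** * Rank one projective modules *)

Section LocalGlobal.
Variable C : comPzRingType.

Definition proper_ideal (J : C -> Prop) : Prop :=
  [/\ J 0, forall x y, J x -> J y -> J (x + y),
      forall x y, J y -> J (x * y) & ~ J 1].

Lemma prime_ideal_above (J : C -> Prop) : proper_ideal J ->
  exists p : prime_ideal C, forall x, J x -> x \in p.
Proof.
move=> [J0 JD JM J1].
(* Taking the union with [J] lets Zorn's lemma handle the empty chain as well: its union gives back
   [J]. *)
pose P (X : set C) := proper_ideal (fun x => J x \/ X x).
have [F FP Ftot|X [[X0 XD XM X1] Xmax]] := @Zorn_bigcup C P.
  have FI x y : (J x \/ (\bigcup_(X in F) X)%classic x) ->
      (J y \/ (\bigcup_(X in F) X)%classic y) -> (J x /\ J y) \/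
      exists X, [/\ F X, J x \/ X x & J y \/ X y].
    move=> [Jx|[X FX Xx]] [Jy|[Y FY Yy]]; first by left.
    - by right; exists Y; split; [|left|right].
    - by right; exists X; split; [|right|left].
    - right; case: (Ftot X Y FX FY) => [XY|YX].
        by exists Y; split; [|right; apply: XY|right].
      by exists X; split; [|right|right; apply: YX].
  split; first by left.
  - move=> x y Hx Hy; case: (FI x y Hx Hy) => [[Jx Jy]|[X [FX Xx Xy]]].
      by left; apply: JD.
    have [_ XD _ _] := FP X FX; case: (XD x y Xx Xy) => ?; first by left.
    by right; exists X.
  - move=> x y [Jy|[X FX Xy]]; first by left; apply: JM.
    have [_ _ XM _] := FP X FX; case: (XM x y (or_intror Xy)) => ?.
      by left.
    by right; exists X.
  - move=> [//|[X FX Xy]]; have [_ _ _] := FP X FX.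
    by apply; right.
pose m (x : C) := `[< J x \/ X x >].
have m0 : 0 \in m by apply/asboolP.
have m1 : 1 \notin m by apply/asboolP.
have mD x y : x \in m -> y \in m -> x + y \in m.
  by move=> /asboolP Hx /asboolP Hy; apply/asboolP/XD.
have mM x y : y \in m -> x * y \in m.
  by move=> /asboolP Hy; apply/asboolP/XM.
have mMI x y : x * y \in m -> (x \in m) || (y \in m).
  move=> mxy; case: (boolP (x \in m)) => //= mx.
  (* [Y] is the ideal $m+Cx$. By maximality it contains $1=i+cx$, so that $y=yi+c(xy)$ lies in [m]
     as soon as $xy$ does. *)
  pose Y : set C := fun z => exists c i, i \in m /\ z = i + c * x.
  have XY : (X `<` Y)%classic.
    split; last first.
      move=> YX; case/negP: mx; apply/asboolP; right; apply: YX.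
      by exists 1, 0; split; [apply/asboolP|rewrite add0r mul1r].
    move=> z Xz; exists 0, z; rewrite mul0r addr0; split=> //.
    by apply/asboolP; right.
  have JY z : J z \/ Y z -> Y z.
    case=> // Jz; exists 0, z; rewrite mul0r addr0; split=> //.
    by apply/asboolP; left.
  have [c [i [mi E]]] : Y 1.
    apply: contrapT => Y1; apply: (Xmax Y XY); split.
    - by left.
    - move=> u v /JY [c [i [mi ->]]] /JY [d [j [mj ->]]]; right.
      exists (c + d), (i + j); split; first exact: mD.
      by rewrite mulrDl addrACA.
    - move=> u v /JY [c [i [mi ->]]]; right.
      exists (u * c), (u * i); split; first exact: mM.
      by rewrite mulrDr mulrA.
    - by move/JY.
  rewrite -[y]mulr1 E mulrDr; apply: mD; first exact: mM.
  by rewrite mulrC -mulrA; apply: mM.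
exists (PrimeIdeal m0 mD mM m1 mMI) => x Jx.
by apply/asboolP; left.
Qed.

(** Otherwise the annihilator of [z] is a proper ideal, and a prime above it contradicts the
    hypothesis. *)
Lemma local_zero (M : lmodType C) (z : M) :
  (forall p : prime_ideal C, exists2 u, u \notin p & u *: z = 0) -> z = 0.
Proof.
move=> zloc; rewrite -[z]scale1r; apply: contrapT => z1.
have [|p Jp] := @prime_ideal_above (fun c => c *: z = 0).
  split=> // [|x y Ex Ey|x y Ey]; first by rewrite scale0r.
    by rewrite scalerDl Ex Ey addr0.
  by rewrite -scalerA Ey scaler0.
by have [u /negP pu /Jp] := zloc p.
Qed.

End LocalGlobal.

Section RankOne.
Variables (C : comPzRingType) (I : lmodType C).

Lemma locZ (p : prime_ideal C) (M : lmodType C) (c : C) (m : M) s :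
  c *: locf m s = locf (c *: m) s :> loc p M.
Proof. exact: loc_scaleE. Qed.

Lemma loc0 (p : prime_ideal C) (M : lmodType C) s :
  locf (0 : M) s = 0 :> loc p M.
Proof. by rewrite -(scale0r (locf 0 s)) locZ scaler0. Qed.

(* Over a prime [p], a generator of I_p is the class of some [e] in I. *)
Lemma rank_one_local_generator (p : prime_ideal C) : rank_one_projective I ->
  exists e : I,
    (forall x : I, exists2 u, u \notin p & exists a, u *: x = a *: e) /\
    (forall c, c *: e = 0 -> exists2 u, u \notin p & u * c = 0).
Proof.
case=> _ _ /(_ p)[th [th' thK th'K]].
pose lC (c : C) := @locf C p C^o c (denom1 p).
(* [e] is a numerator of the preimage of 1 under the isomorphism at [p]. *)
have [e [r Er]] : exists e r, th' (lC 1) = locf e r.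
  pose z := loc_repr (th' (lC 1)).
  by exists z.1, z.2; rewrite loc_reprK.
have thE : th (locf e r) = lC 1 by rewrite -Er th'K.
exists e; split=> [x|c ce].
  pose y := th (locf x (denom1 p)).
  pose a : C := (loc_repr y).1; pose s := (loc_repr y).2.
  have yE : y = @locf C p C^o a s by rewrite loc_reprK.
  have : locf (val s *: x) (denom1 p) = locf (a *: e) r.
    apply: (can_inj thK); rewrite -!locZ !linearZ /= thE -/y yE !locZ.
    by apply: loc_eq; rewrite /= scale1r; congr (_ *: _); apply: esym (mulr1 a).
  case/locfP=> u pu /= E.
  exists (u * (val r * val s)).
    exact: (denomM_subproof (exist _ u pu) (denomM r s)).
  by exists (u * a); rewrite -!scalerA E scale1r.
have : lC c = lC 0.
  have -> : lC c = th (locf (c *: e) r).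
    rewrite -locZ linearZ thE /= locZ; apply: loc_eq.
    by rewrite /= [c *: _]mulr1.
  by rewrite ce /lC !loc0 linear0.
case/locfP=> u pu /= E; exists u => //.
by rewrite !scale1r scaler0 in E.
Qed.

Let formZ (f : {linear I -> C^o}) (c : C) m :
  f (c *: m) = (c : C) * (f m : C) :> C.
Proof. exact: (linearZ_LR f). Qed.

(** The exchange law $g(y)z=g(z)y$ holds at each prime because [y] and [z] are there multiples of
    one element. It makes $t=\sum f_j(x_j)$ act as the identity on [I], and local generators have
    locally zero annihilator, so $t=1$. *)
Lemma rank_one_dual_basis : rank_one_projective I ->
  exists (J : finType) (x : J -> I) (f : J -> {linear I -> C^o}),
  [/\ forall m, m = \sum_j (f j m : C) *: x j, \sum_j f j (x j) = 1 &
      forall (g : {linear I -> C^o}) (y z : I),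
        (g y : C) *: z = (g z : C) *: y].
Proof.
move=> I1; have [Ifg Ipr _] := I1.
have [J [x [f fx]]] : has_dual_basis I by apply/dual_basisP.
have swap (g : {linear I -> C^o}) y z : (g y : C) *: z = (g z : C) *: y.
  apply: subr0_eq; apply: local_zero => p.
  have [e [epr _]] := rank_one_local_generator p I1.
  have [u pu [a Ea]] := epr y; have [v pv [b Eb]] := epr z.
  exists (u * v); first exact: (denomM_subproof (exist _ u pu) (exist _ v pv)).
  have E (c d : C) (w w' : I) :
      (c * d) *: ((g w : C) *: w') = (g (c *: w) : C) *: (d *: w').
    by rewrite formZ !scalerA; congr (_ *: _); ring.
  rewrite scalerBr E [u * v]mulrC E Ea Eb !formZ !scalerA -scalerBl.
  by rewrite [X in X *: _](_ : _ = 0) ?scale0r //; ring.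
exists J, x, f; split=> //; pose t : C := \sum_j f j (x j).
have tI (m : I) : t *: m = m.
  by rewrite [RHS]fx scaler_suml; apply: eq_bigr => j _; rewrite swap.
apply/esym/subr0_eq; apply: (@local_zero C C^o) => p.
have [e [_ efaith]] := rank_one_local_generator p I1.
by apply: efaith; rewrite scalerBl tI scale1r subrr.
Qed.

(* At a prime [p], the third hypothesis supplies [j] with [f j (x j)] outside
   [p]; then [f j] and [a |-> a x_j / f_j(x_j)] are inverse to each other
   at [p]. *)
Lemma rank_one_of_trace :
  has_dual_basis I ->
  (forall (f : {linear I -> C^o}) x,
    exists c, forall y, (f y : C) *: x = c *: y) ->
  has_trace_one I -> rank_one_projective I.
Proof.
move=> /dual_basisP[Ifg Ipr] scal [J [x [f fx1]]]; split=> // p.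
(* If all $f_j(x_j)$ were in [p], their sum 1 would be too. *)
have [j pj] : exists j, f j (x j) \notin p.
  apply: contrapT => H; have /negP := prime1N p; apply.
  rewrite -fx1; apply: (big_ind (fun c : C => c \in p)) => [||j _].
  - exact: prime0.
  - exact: primeD.
  - by apply: contrapT => pj; apply: H; exists j; apply/negP.
pose s := f j (x j) : C; have [c cP] := scal (f j) (x j).
pose sd : {s : C | s \notin p} := exist _ s pj.
pose F (m : loc p I) : loc p C^o := locf (f j (loc_repr m).1) (loc_repr m).2.
pose G (a : loc p C^o) : loc p I :=
  locf (((loc_repr a).1 : C) *: x j) (denomM (loc_repr a).2 sd).
have FE m t : F (locf m t) = locf (f j m) t.
  have [u pu E] := loc_reprP m t; apply/locfP; exists u => //.
  by have := congr1 (f j) E; rewrite 4!formZ.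
have GE (a : C) t : G (@locf C p C^o a t) = locf (a *: x j) (denomM t sd).
  have [u pu E] := @loc_reprP C p C^o a t; apply/locfP; exists u => //=.
  have {}E : u * (sval t * (loc_repr (@locf C p C^o a t)).1 : C) =
    u * (sval (loc_repr (@locf C p C^o a t)).2 * a) := E.
  rewrite !scalerA; congr (_ *: _).
  transitivity (s * (u * (sval t * (loc_repr (@locf C p C^o a t)).1 : C))).
    by ring.
  by rewrite E; ring.
have FL : linear F.
  move=> d v w; rewrite -[v]loc_reprK -[w]loc_reprK.
  rewrite [d *: _]loc_scaleE [X in F X]loc_addE !FE.
  rewrite [d *: _]loc_scaleE [RHS]loc_addE.
  by rewrite linearD 3!formZ.
exists (mk_linear FL), G => v /=; rewrite -[v]loc_reprK.
  rewrite FE GE; apply/locfP; exists s => //=.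
  rewrite -/s cP !scalerA.
  (* Apply [f j] to $f_j(x_j)x_j=cx_j$. As [s] is outside [p], this makes [c] and [s] agree at
     [p]. *)
  have sc : s * c = s * s.
    by rewrite mulrC -formZ -cP formZ.
  congr (_ *: _); rewrite mulrAC sc -/s; ring.
rewrite GE FE; apply: loc_eq; rewrite formZ /= -/s.
by rewrite -[RHS]/((sval _ * s) * _) -[LHS]/(sval _ * _); ring.
Qed.
End RankOne.

(** * Endomorphisms of tensor products *)

Definition mk_rmorphism (R S : pzRingType) (f : R -> S)
    (fB : zmod_morphism f) (fM : monoid_morphism f) : {rmorphism R -> S} :=
  HB.pack f (GRing.isZmodMorphism.Build R S f fB)
            (GRing.isMonoidMorphism.Build R S f fM).

Section AlgebraIsomorphisms.
Variable C : comPzRingType.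
Implicit Types A B D : algebra C.

Lemma alg_isomorphic_trans B A D :
  alg_isomorphic A B -> alg_isomorphic B D -> alg_isomorphic A D.
Proof.
move=> [f [fbij fC]] [g [gbij gC]].
exists (g \o f : {rmorphism A -> D}); split; first exact: bij_comp.
by move=> c /=; rewrite fC gC.
Qed.

Lemma end_alg_iso A (M N : lmodType A) :
  mod_isomorphic M N -> alg_isomorphic (end_alg M) (end_alg N).
Proof.
move=> [f [g fK gK]].
have gl : linear g.
  by move=> a u v; apply: (can_inj fK); rewrite linearP !gK.
have hl (b : endo M) : linear (fun n => f (b (g n))).
  by move=> a u v; rewrite gl !linearP.
pose h (b : end_alg M) : end_alg N := mk_linear (hl b).
have hl' (b : endo N) : linear (fun n => g (b (f n))).
  by move=> a u v; rewrite -gl !linearP.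
have hB : zmod_morphism h.
  by move=> b d; apply: linear_ext => n /=; rewrite linearB.
have hM : monoid_morphism h.
  by split=> [|b d]; apply: linear_ext => n /=; rewrite ?gK ?fK.
exists (mk_rmorphism hB hM); split=> [|c].
  exists (fun b => mk_linear (hl' b) : end_alg M) => b;
      apply: linear_ext => n /=.
    by rewrite !fK.
  by rewrite !gK.
by apply: linear_ext => n /=; rewrite linearZ /= gK.
Qed.

End AlgebraIsomorphisms.

Section TensorLinear.
Variables (C : comPzRingType) (R : algebra C) (I : lmodType C) (P : lmodType R).

Lemma tens_lift_linear (Q : lmodType R) (f : I -> P -> Q) :
  balanced f -> (forall a i p, f i (a *: p) = a *: f i p) ->
  linear (tens_lift f).
Proof.
move=> fbal fZ a u v; rewrite (tens_liftD fbal); congr (_ + _).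
elim/tens_ind: u => [|x y Ex Ey|i p].
- by rewrite scaler0 (tens_lift0 fbal) scaler0.
- by rewrite scalerDr !(tens_liftD fbal) Ex Ey scalerDr.
- by rewrite tensorZr !(tens_liftE fbal).
Qed.

Lemma tensor0 i : tensor i 0 = 0 :> tens I P.
Proof. by apply: (addIr (tensor i 0)); rewrite -tensorDr !add0r. Qed.

Lemma tensor_suml (J : finType) (i : J -> I) (p : P) :
  tensor (\sum_j i j) p = \sum_j tensor (i j) p :> tens I P.
Proof.
have t0 : tensor 0 p = 0 :> tens I P.
  by apply: (addIr (tensor 0 p)); rewrite -tensorDl !add0r.
exact: (big_morph (fun i => tensor i p : tens I P)
  (fun x y => tensorDl x y p) t0).
Qed.

Lemma tensor_sumr (J : finType) i (p : J -> P) :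
  tensor i (\sum_j p j) = \sum_j tensor i (p j) :> tens I P.
Proof.
exact: (big_morph (fun p => tensor i p : tens I P) (tensorDr i) (tensor0 i)).
Qed.

Lemma tensorNr i p : tensor i (- p) = - tensor i p :> tens I P.
Proof. by rewrite -!scaleN1r tensorZr. Qed.

Section Contraction.
Variable f : {linear I -> C^o}.

(** This gives $f\otimes\mathrm{id}$ followed by $C\otimes P=P$. *)
Definition contract_fun (i : I) (p : P) : P := alg_in R (f i) *: p.

Lemma contract_bal : balanced contract_fun.
Proof.
rewrite /contract_fun; split=> [i i' p|i p p'|c i p].
- by rewrite linearD rmorphD scalerDl.
- exact: scalerDr.
- have -> : f (c *: i) = (c : C) * (f i : C) by apply: (linearZ_LR f).
  by rewrite scalerA -rmorphM mulrC.
Qed.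

Lemma contract_lin : linear (tens_lift contract_fun).
Proof.
apply: tens_lift_linear contract_bal _ => a i p.
by rewrite /contract_fun !scalerA alg_inC.
Qed.

Definition contract : {linear tens I P -> P} := mk_linear contract_lin.

Lemma contractE i p : contract (tensor i p) = alg_in R (f i) *: p.
Proof. exact: tens_liftE contract_bal _ _. Qed.

End Contraction.

Section EndTensor.

Definition tens_id_fun (b : endo P) (i : I) (p : P) : tens I P :=
  tensor i (b p).
Lemma tens_id_bal b : balanced (tens_id_fun b).
Proof.
rewrite /tens_id_fun; split=> [i i' p|i p p'|c i p].
- exact: tensorDl.
- by rewrite linearD tensorDr.
- by rewrite tensorZ linearZ.
Qed.
Lemma tens_id_lin b : linear (tens_lift (tens_id_fun b)).
Proof.
apply: tens_lift_linear (tens_id_bal b) _ => a i p.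
by rewrite /tens_id_fun linearZ tensorZr.
Qed.
Definition tens_id (b : end_alg P) : end_alg (tens I P) :=
  mk_linear (tens_id_lin b).
Lemma tens_idE (b : end_alg P) i p :
  (tens_id b : endo _) (tensor i p) = tensor i ((b : endo P) p).
Proof. exact: tens_liftE (tens_id_bal b) _ _. Qed.

Lemma endo_tens_ext (g h : endo (tens I P)) :
  (forall i p, g (tensor i p) = h (tensor i p)) -> g = h.
Proof.
move=> gh; apply: linear_ext; apply: tens_ind => [|x y Ex Ey|//].
  by rewrite !linear0.
by rewrite !linearD Ex Ey.
Qed.

(** The isomorphism is $b\mapsto\mathrm{id}\otimes b$. Its inverse is a partial trace over [I]: one
    composite is the identity since $\sum f_j(x_j)=1$, the other by the exchange law. *)
Lemma end_tensor_rank_one : rank_one_projective I ->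
  alg_isomorphic (end_alg P) (end_alg (tens I P)).
Proof.
move=> /rank_one_dual_basis[J [x [f [fx f1 fswap]]]].
have hB : zmod_morphism tens_id.
  move=> b d; apply: endo_tens_ext => i p; rewrite tens_idE /=.
  by rewrite tensorDr tensorNr !(tens_liftE (tens_id_bal _)).
have hM : monoid_morphism tens_id.
  by split=> [|b d]; apply: endo_tens_ext => i p;
    rewrite /= !(tens_liftE (tens_id_bal _)).
pose inv (h : endo (tens I P)) p := \sum_j contract (f j) (h (tensor (x j) p)).
have invl h : linear (inv h).
  move=> a u v; rewrite /inv scaler_sumr -big_split; apply: eq_bigr => j _.
  by rewrite tensorDr -tensorZr 2!linearP.
(* The exchange law for [I], carried over to the tensor product. *)
have tens_contract g y (z : tens I P) : tensor y (contract g z) =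
    alg_in R (g y) *: z.
  elim/tens_ind: z => [|u v Eu Ev|i p].
  - by rewrite linear0 tensor0 scaler0.
  - by rewrite linearD tensorDr Eu Ev scalerDr.
  - by rewrite contractE -tensorZ fswap tensorZ tensorZr.
exists (mk_rmorphism hB hM); split; last first.
  by move=> c; apply: endo_tens_ext => i p; rewrite tens_idE /= tensorZr.
exists (fun h : end_alg (tens I P) => mk_linear (invl h) : end_alg P)
  => [b|h] /=.
  apply: linear_ext => p /=; rewrite /inv.
  under eq_bigr => j _ do rewrite tens_idE contractE.
  by rewrite -scaler_suml -rmorph_sum f1 rmorph1 scale1r.
apply: endo_tens_ext => i p; rewrite tens_idE /= /inv tensor_sumr.
under eq_bigr => j _ do rewrite tens_contract -linearZ tensorZr -tensorZ.
by rewrite -linear_sum -tensor_suml -fx.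
Qed.

End EndTensor.
End TensorLinear.

(** * Azumaya algebras *)

Section AzumayaSandwich.
Variables (C : comPzRingType) (A : algebra C).
Hypothesis A_azu : azumaya A.

(** The list of pairs stands for an element of $A\otimes A^{\mathrm{op}}$, and the value is its
    image under the Azumaya map. *)
Definition sandwich (s : seq (A * A)) (x : A) : A :=
  \sum_(p <- s) p.1 * x * p.2.

Definition alg_balanced (G : zmodType) (f : A -> A -> G) : Prop :=
  [/\ forall u u' v, f (u + u') v = f u v + f u' v,
      forall u v v', f u (v + v') = f u v + f u v' &
      forall c u v, f (alg_in A c * u) v = f u (alg_in A c * v)].

Lemma azumaya_sandwich_surj (T : {linear alg_mod A -> alg_mod A}) :
  exists s, forall x : A, T x = sandwich s x.
Proof.
case: A_azu => _ [phi [[phi' phiK phi'K] _] phiE].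
pose z := phi' (T : end_alg (A := base_alg C) (alg_mod A)).
exists (tens_repr z) => x.
have <- : (phi z : endo _) x = T x by rewrite phi'K.
rewrite -{1}[z]tens_reprK tens_classE rmorph_sum.
have phi_sum (s : seq (A * A)) :
  (\sum_(p <- s) phi (tensa p.1 (p.2 : op_alg A)) : endo (alg_mod A)) x =
  sandwich s x.
  rewrite /sandwich; elim: s => [|p s IH]; first by rewrite !big_nil.
  by rewrite !big_cons /= IH phiE.
exact: phi_sum.
Qed.

(** By injectivity of the Azumaya map both lists represent the same tensor, and a balanced map
    factors through the tensor product. *)
Lemma azumaya_sandwich_inj (s t : seq (A * A)) : sandwich s =1 sandwich t ->
  forall (G : zmodType) (f : A -> A -> G), alg_balanced f ->
  \sum_(p <- s) f p.1 p.2 = \sum_(p <- t) f p.1 p.2.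
Proof.
case: A_azu => _ [phi [[phi' phiK phi'K] _] phiE] st G f [fDl fDr fZ].
pose cl (s : seq (A * A)) : tens_alg A (op_alg A) :=
  \sum_(p <- s) tensa p.1 (p.2 : op_alg A).
have phi_cl r x : (phi (cl r) : endo _) x = sandwich r x.
  rewrite /sandwich /cl; elim: r => [|p r IH].
    by rewrite !big_nil rmorph0.
  by rewrite !big_cons rmorphD /= IH phiE.
have E : cl s = cl t.
  by apply: (can_inj phiK); apply: linear_ext => x; rewrite !phi_cl st.
pose g (u : alg_mod A) (v : (op_alg A)^o) : G := f u v.
have gbal : balanced g.
  split; [exact: fDl|exact: fDr|move=> c u v].
  by rewrite [LHS]fZ alg_inC.
have lift_cl r : tens_lift g (cl r) = \sum_(p <- r) f p.1 p.2.
  rewrite /cl; elim: r => [|p r IH].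
    by rewrite !big_nil (tens_lift0 gbal).
  by rewrite !big_cons (tens_liftD gbal) IH (tens_liftE gbal).
by rewrite -!lift_cl E.
Qed.

End AzumayaSandwich.

(** * Intertwiners *)

Section Intertwiners.
Variables (C : comPzRingType) (R : algebra C) (P Q : lmodType R).
Variable psi : endo P -> endo Q.

(** When [psi] comes from an isomorphism of endomorphism algebras, this is the module $I$ with
    $I\otimes P\cong Q$: the maps linear over both $A$ and $\mathrm{End}_A(P)$. *)
Record intertwiner := Intertwiner {
  intertwiner_hom :> {linear P -> Q};
  intertwinerP : forall (b : endo P) p,
    intertwiner_hom (b p) = psi b (intertwiner_hom p)
}.

Lemma intertwiner_ext (h k : intertwiner) : h =1 k -> h = k.
Proof.
case: h k => [h hP] [k kP] /= /linear_ext hk; subst k.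
by rewrite (Prop_irrelevance hP kP).
Qed.

Definition mk_intertwiner (h : P -> Q) (hl : linear h)
    (hP : forall (b : endo P) p, h (b p) = psi b (h p)) : intertwiner :=
  @Intertwiner (mk_linear hl) hP.

HB.instance Definition _ := gen_eqMixin intertwiner.
HB.instance Definition _ := gen_choiceMixin intertwiner.

Fact intertwiner_zero_int (b : endo P) (p : P) : 0 = psi b 0.
Proof. by rewrite linear0. Qed.
Fact intertwiner_opp_int (h : intertwiner) (b : endo P) p :
  - h (b p) = psi b (- h p).
Proof. by rewrite linearN intertwinerP. Qed.
Fact intertwiner_add_int (h k : intertwiner) (b : endo P) p :
  h (b p) + k (b p) = psi b (h p + k p).
Proof. by rewrite linearD !intertwinerP. Qed.
Fact intertwiner_scale_lin c (h : intertwiner) :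
  linear (fun p => alg_in R c *: h p).
Proof. by move=> a u v; rewrite linearP scalerDr !scalerA alg_inC. Qed.
Fact intertwiner_scale_int c (h : intertwiner) (b : endo P) p :
  alg_in R c *: h (b p) = psi b (alg_in R c *: h p).
Proof. by rewrite linearZ intertwinerP. Qed.

Definition intertwiner_zero :=
  mk_intertwiner (@hom_zero_lin _ P Q) intertwiner_zero_int.
Definition intertwiner_opp (h : intertwiner) :=
  mk_intertwiner (hom_opp_lin (h : Defs.hom P Q)) (intertwiner_opp_int h).
Definition intertwiner_add (h k : intertwiner) :=
  mk_intertwiner (hom_add_lin (h : Defs.hom P Q) (k : Defs.hom P Q))
    (intertwiner_add_int h k).
Definition intertwiner_scale c (h : intertwiner) :=
  mk_intertwiner (intertwiner_scale_lin c h) (intertwiner_scale_int c h).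

Fact intertwiner_addA : associative intertwiner_add.
Proof. by move=> f g h; apply: intertwiner_ext => u /=; rewrite addrA. Qed.
Fact intertwiner_addC : commutative intertwiner_add.
Proof. by move=> f g; apply: intertwiner_ext => u /=; rewrite addrC. Qed.
Fact intertwiner_add0 : left_id intertwiner_zero intertwiner_add.
Proof. by move=> f; apply: intertwiner_ext => u /=; rewrite add0r. Qed.
Fact intertwiner_addN :
  left_inverse intertwiner_zero intertwiner_opp intertwiner_add.
Proof. by move=> f; apply: intertwiner_ext => u /=; rewrite addNr. Qed.
HB.instance Definition _ :=
  GRing.isZmodule.Build intertwiner
    intertwiner_addA intertwiner_addC intertwiner_add0 intertwiner_addN.

Fact intertwiner_scaleA c d h :
  intertwiner_scale c (intertwiner_scale d h) = intertwiner_scale (c * d) h.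
Proof. by apply: intertwiner_ext => p /=; rewrite scalerA rmorphM. Qed.
Fact intertwiner_scale1 : left_id 1 intertwiner_scale.
Proof.
by move=> h; apply: intertwiner_ext => p /=; rewrite rmorph1 scale1r.
Qed.
Fact intertwiner_scaleDr : right_distributive intertwiner_scale +%R.
Proof. by move=> c h k; apply: intertwiner_ext => p /=; rewrite scalerDr. Qed.
Fact intertwiner_scaleDl h : {morph intertwiner_scale^~ h : c d / c + d}.
Proof.
by move=> c d; apply: intertwiner_ext => p /=; rewrite rmorphD scalerDl.
Qed.
HB.instance Definition _ := GRing.Zmodule_isLmodule.Build C intertwiner
  intertwiner_scaleA intertwiner_scale1 intertwiner_scaleDr intertwiner_scaleDl.

Definition intertwiner_eval_fun (h : intertwiner) (p : P) : Q := h p.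
Lemma intertwiner_eval_bal : balanced intertwiner_eval_fun.
Proof.
rewrite /intertwiner_eval_fun; split=> // [h p p'|c h p].
  by rewrite linearD.
by rewrite linearZ.
Qed.
Lemma intertwiner_eval_lin : linear (tens_lift intertwiner_eval_fun).
Proof.
apply: tens_lift_linear intertwiner_eval_bal _ => a h p.
by rewrite /intertwiner_eval_fun linearZ.
Qed.
Definition intertwiner_eval : {linear tens intertwiner P -> Q} :=
  mk_linear intertwiner_eval_lin.
Lemma intertwiner_evalE h p : intertwiner_eval (tensor h p) = h p.
Proof. exact: tens_liftE intertwiner_eval_bal _ _. Qed.

End Intertwiners.

(** * Forms on an Azumaya algebra, restriction of modules to the base ring, and the center *)

Section AzumayaModules.
Variables (C : comPzRingType) (A : algebra C).
Hypothesis A_azu : azumaya A.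
Notation R := (op_alg A).

(** Surjectivity of the Azumaya map, applied to the $C$-linear endomorphism $x\mapsto g(x)1$ of
    [A]. *)
Lemma azumaya_form (g : {linear alg_mod A -> C^o}) :
  exists s, forall x : A, sandwich s x = alg_in A (g x : C).
Proof.
have gl : linear (fun x : alg_mod A => alg_in A (g x : C) : alg_mod A).
  by move=> c x y; rewrite linearP rmorphD rmorphM.
have [s sP] := azumaya_sandwich_surj A_azu (mk_linear gl).
by exists s => x; rewrite -sP.
Qed.

(** The tensors $\sum au\otimes v$ and $\sum u\otimes va$ act on [x] by $ag(x)$ and $g(x)a$. These
    are equal because $g(x)$ is central, so injectivity of the Azumaya map applies. *)
Lemma form_commute (g : A -> C) s :
  (forall x : A, sandwich s x = alg_in A (g x)) ->
  forall (G : zmodType) (f : A -> A -> G) a, alg_balanced f ->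
  \sum_(p <- s) f (a * p.1) p.2 = \sum_(p <- s) f p.1 (p.2 * a).
Proof.
move=> sP G f a fbal.
have E : sandwich [seq (a * p.1, p.2) | p <- s] =1
         sandwich [seq (p.1, p.2 * a) | p <- s].
  move=> x; rewrite /sandwich !big_map /=.
  under eq_bigr => p _ do rewrite -!mulrA.
  under [RHS]eq_bigr => p _ do rewrite mulrA.
  rewrite -mulr_sumr -mulr_suml.
  under eq_bigr => p _ do rewrite mulrA.
  by rewrite -/(sandwich s x) sP alg_inC.
by have := azumaya_sandwich_inj A_azu E fbal; rewrite !big_map.
Qed.

Section Restrict.
Variable M : lmodType R.

Lemma azumaya_form_lin (g : {linear alg_mod A -> C^o}) (y : {linear M -> R^o}) :
  linear (fun m : restr (alg_in R) M => g (y m) : C^o).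
Proof.
move=> c u v.
have -> : y (c *: u + v) = c *: (y u : alg_mod A) + (y v : alg_mod A).
  apply: etrans (linearP y (alg_in R c) u v) _; congr (_ + _).
  exact: esym (alg_inC c (y u : A)).
by rewrite linearP.
Qed.

(** Multiplies a dual basis of [M] over the algebra by one of [A] over [C]. *)
Lemma restr_has_dual_basis :
  has_dual_basis M -> has_dual_basis (restr (alg_in R) M).
Proof.
case: A_azu => -[Afg Apr _] _.
have [J [a [g ga]]] : has_dual_basis (alg_mod A) by apply/dual_basisP.
move=> [L [y [w yw]]].
exists (L * J)%type, (fun k => (a k.2 : R) *: y k.1),
  (fun k => mk_linear (azumaya_form_lin (g k.2) (w k.1))) => m.
rewrite -(pair_bigA _ (fun l j => (g j (w l m) : C) *:
  ((a j : R) *: y l : restr (alg_in R) M))) /=.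
rewrite {1}[m]yw; apply: eq_bigr => l _.
rewrite {1}[w l m](ga (w l m)) scaler_suml; apply: eq_bigr => j _.
apply: etrans (esym (scalerA (alg_in R (g j (w l m) : C) : R) (a j : R) (y l))).
by congr (_ *: _); apply: (alg_inC _ (a j : A)).
Qed.

(** For the forms $g_j\circ w_k$ and the elements $p_kd_j$, summing over $k$ first gives
    $\sum_kw_k(p_kd_j)=d_j$, and then $\sum_jg_j(d_j)=1$. *)
Lemma restr_has_trace_one :
  has_trace_one M -> has_trace_one (restr (alg_in R) M).
Proof.
case: A_azu => -[_ _ /generator_trace_one [J [d [g gd]]]] _.
move=> [K [p [w wp]]].
exists (K * J)%type, (fun k => (d k.2 : R) *: p k.1),
  (fun k => mk_linear (azumaya_form_lin (g k.2) (w k.1))) => /=.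
rewrite -(pair_bigA _ (fun k j => g j (w k ((d j : R) *: p k)) : C^o)).
rewrite exchange_big -[RHS]gd; apply: eq_bigr => j _ /=.
rewrite -linear_sum; congr (g j _).
transitivity ((d j : R) *: (\sum_k w k (p k))).
  by rewrite scaler_sumr; apply: eq_bigr => k _; apply: linearZ_LR.
by rewrite wp; apply: mul1r (d j : A).
Qed.

End Restrict.

(** Write each form [g j] as a sandwich. A central [a] moves inside it, so $g_j(d_j)a=g_j(d_ja)$;
    now sum over $j$. *)
Lemma azumaya_center (a : A) : (forall b, a * b = b * a) ->
  exists c, a = alg_in A c.
Proof.
move=> aC; case: A_azu => -[_ _ /generator_trace_one [J [d [g gd]]]] _.
exists (\sum_j (g j (d j * a : A) : C)); rewrite rmorph_sum.
rewrite -[LHS]mul1r -(rmorph1 (alg_in A)) -gd rmorph_sum mulr_suml.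
apply: eq_bigr => j _; have [s sP] := azumaya_form (g j).
rewrite -!sP mulr_suml; apply: eq_bigr => p _.
by rewrite -!mulrA aC.
Qed.

End AzumayaModules.


Section RankOneHom.
Variables (R : pzRingType) (M N : lmodType R).

Lemma elem_hom_lin (y : {linear M -> R^o}) (n : N) :
  linear (fun m => (y m : R) *: n).
Proof. by move=> a u v; rewrite linearP scalerDl scalerA. Qed.
Definition elem_hom y n : {linear M -> N} := mk_linear (elem_hom_lin y n).

End RankOneHom.

(** * Averaging into intertwiners, and bijectivity of evaluation *)

Section AzumayaEnd.
Variables (C : comPzRingType) (A : algebra C).
Hypothesis A_azu : azumaya A.
Notation R := (op_alg A).
Variables (P Q : lmodType R) (psi : {rmorphism end_alg P -> end_alg Q}).
Hypothesis psiC : forall c, psi (alg_in _ c) = alg_in _ c.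

Let Psi (b : endo P) : endo Q := psi b.

Let PsiD b d q : Psi (b + d) q = Psi b q + Psi d q.
Proof. by rewrite /Psi rmorphD. Qed.
Let PsiM b d q : Psi (b * d) q = Psi b (Psi d q).
Proof. by rewrite /Psi rmorphM. Qed.
Let PsiC c q : Psi (end_in P c) q = alg_in R c *: q.
Proof. by rewrite /Psi psiC. Qed.

Let pure (y : {linear P -> R^o}) (p : P) : endo P := elem_hom y p.

Let pureD y p p' : pure y (p + p') = pure y p + pure y p'.
Proof. by apply: linear_ext => x /=; rewrite scalerDr. Qed.
Let pureM y (b : endo P) p : pure y (b p) = b * pure y p.
Proof. by apply: linear_ext => x /=; rewrite linearZ. Qed.
Let pureZ y c p : pure y (alg_in R c *: p) = end_in P c * pure y p.
Proof.
apply: linear_ext => x /=; rewrite !scalerA; congr (_ *: _).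
exact: esym (alg_inC c (y x : R)).
Qed.

Section Average.
Variables (g : A -> C) (s : seq (A * A)).
Hypothesis s_g : forall x : A, sandwich s x = alg_in A (g x).
Variables (y : {linear P -> R^o}) (q : Q).

(** The map $p\mapsto\psi(y(-)p)(q)$ respects the action of $\mathrm{End}_A(P)$ but need not be
    $A$-linear. The sum over [s] averages it into an $A$-linear map. *)
Definition average_fun (p : P) : Q :=
  \sum_(u <- s) (u.2 : R) *: Psi (pure y ((u.1 : R) *: p)) q.

Lemma average_bal p : alg_balanced (A := A)
  (fun u v : A => (v : R) *: Psi (pure y ((u : R) *: p)) q).
Proof.
split=> [u u' v|u v v'|c u v].
- by rewrite -scalerDr -PsiD -pureD -scalerDl.
- exact: scalerDl.
- have -> : ((alg_in A c * u : A) : R) *: p = alg_in R c *: ((u : R) *: p).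
    by rewrite scalerA; congr (_ *: _); apply: (alg_inC c u).
  by rewrite pureZ PsiM PsiC scalerA.
Qed.

Lemma average_lin : linear average_fun.
Proof.
have D : {morph average_fun : p p' / p + p'}.
  move=> p p'; rewrite /average_fun -big_split; apply: eq_bigr => u _ /=.
  by rewrite scalerDr pureD PsiD scalerDr.
move=> a p p'; rewrite D; congr (_ + _).
rewrite /average_fun scaler_sumr.
(* Moves [a] from the first leg of the tensor to the second, where it acts on the value. *)
have := form_commute A_azu s_g a (average_bal p).
rewrite (eq_bigr (fun u : A * A =>
  (u.2 : R) *: Psi (pure y ((u.1 : R) *: (a *: p))) q)).
  by move=> ->; apply: eq_bigr => u _; rewrite scalerA.
by move=> u _; rewrite scalerA.
Qed.

Lemma average_int (b : endo P) p : average_fun (b p) = Psi b (average_fun p).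
Proof.
rewrite /average_fun linear_sum; apply: eq_bigr => u _.
have -> : (u.1 : R) *: b p = b ((u.1 : R) *: p) by rewrite linearZ.
by rewrite pureM PsiM [RHS]linearZ.
Qed.

Definition average : intertwiner Psi := mk_intertwiner average_lin average_int.

End Average.

(** The inverse [sec] combines a dual basis [z], [y] of [P] over the algebra with a dual basis [a],
    [g] of [A] over [C], averaging with the sandwich of each [g j]. *)
Theorem intertwiner_eval_bij :
  has_dual_basis P -> bijective (intertwiner_eval Psi).
Proof.
case: (A_azu) => -[Afg Apr _] _.
have [J [a [g ga]]] : has_dual_basis (alg_mod A) by apply/dual_basisP.
move=> [L [z [y yz]]].
have /choice[s sP] j := azumaya_form A_azu (g j).
pose sec q := \sum_l \sum_j tensor (average (sP j) (y l) q) ((a j : R) *: z l).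
have secD : {morph sec : q q' / q + q'}.
  move=> q q'; rewrite /sec -big_split; apply: eq_bigr => l _ /=.
  rewrite -big_split; apply: eq_bigr => j _ /=.
  rewrite -tensorDl; congr (tensor _ _); apply: intertwiner_ext => p /=.
  rewrite /average_fun -big_split; apply: eq_bigr => u _ /=.
  by rewrite linearD scalerDr.
(* Since $\sum_jg_j(x)a_j=x$, the tensors of the forms [g j], multiplied by [a j] and added up, act
   like $1\otimes1$. *)
have sum_unit : sandwich
    (flatten [seq [seq (p.1, p.2 * (a j : A)) | p <- s j] | j <- enum J]) =1
    sandwich [:: (1, 1)].
  move=> x; rewrite /sandwich big_flatten big_map big_enum big_seq1 /=.
  rewrite mul1r mulr1.
  rewrite [RHS]ga; apply: eq_bigr => j _; rewrite big_map /=.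
  under eq_bigr => p _ do rewrite mulrA.
  by rewrite -mulr_suml -/(sandwich _ _) sP.
exists sec.
  apply: tens_ind => [|v w Ev Ew|h p].
  - by rewrite linear0; apply: (addIr (sec 0)); rewrite -secD !add0r.
  - by rewrite linearD secD Ev Ew.
  rewrite intertwiner_evalE {2}[p]yz tensor_sumr; apply: eq_bigr => l _.
  rewrite [y l p]ga scaler_suml tensor_sumr; apply: eq_bigr => j _.
  (* As [h] intertwines, each term is $h(p')$ multiplied by $u\,y_l(p)\,v$, and these add up to the
     scalar $g_j(y_l(p))$. *)
  have -> : average (sP j) (y l) (h p) = (g j (y l p) : C) *: h.
    apply: intertwiner_ext => p' /=.
    rewrite /average_fun -sP /sandwich scaler_suml.
    apply: eq_bigr => u _; rewrite -intertwinerP /= !linearZ /= !scalerA.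
    by rewrite -[in RHS]mulrA.
  rewrite tensorZ scalerA; congr (tensor _ (_ *: _)).
  exact: esym (alg_inC _ (a j : A)).
move=> q; rewrite /sec linear_sum.
(* By [sum_unit] the averages collapse to the term $u=v=1$. What remains is
   $\psi(\sum_ly_l(-)z_l)=\psi(1)$ applied to [q]. *)
transitivity (\sum_l Psi (pure (y l) (z l)) q).
  apply: eq_bigr => l _; rewrite linear_sum.
  have E := azumaya_sandwich_inj A_azu sum_unit (average_bal (y l) q (z l)).
  rewrite big_seq1 /= !scale1r in E; rewrite -E.
  rewrite big_flatten big_map big_enum; apply: eq_bigr => j _.
  rewrite intertwiner_evalE linearZ /= /average_fun scaler_sumr big_map.
  by apply: eq_bigr => u _; rewrite scalerA.
have Psi_sum (b : L -> endo P) : \sum_l Psi (b l) q = Psi (\sum_l b l) q.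
  apply: esym; apply: (big_morph (fun b => Psi b q)) => [b1 b2|].
    exact: PsiD.
  by rewrite /Psi rmorph0.
rewrite Psi_sum (_ : \sum_l _ = 1); first by rewrite /Psi rmorph1.
apply: linear_ext => p; rewrite [RHS]yz.
by apply: (big_morph (fun b : endo P => b p)).
Qed.

End AzumayaEnd.


(** * Passage of dual bases and trace identities from $I\otimes P\cong Q$ to $I$ *)

Section TensorFactor.
Variables (C : comPzRingType) (R : algebra C).
Variables (I : lmodType C) (P Q : lmodType R).
Variable ev : {linear tens I P -> Q}.
Hypothesis ev_bij : bijective ev.

Section ContractRight.
Variable l : {linear restr (alg_in R) P -> C^o}.

(** This gives $\mathrm{id}\otimes l$ with values in $I\otimes C=I$. The form [l] is linear over [C]
    only, hence the restriction of scalars. *)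
Let contr_fun (i : I) (p : P) : I := (l p : C) *: i.

Let contr_bal : balanced contr_fun.
Proof.
rewrite /contr_fun; split=> [i i' p|i p p'|c i p].
- exact: scalerDr.
- have -> : l (p + p' : P) = l p + l p' by apply: (linearD l).
  exact: scalerDl.
- have -> : l (alg_in R c *: p : P) = (c : C) * (l p : C).
    by apply: (linearZ_LR l).
  by rewrite scalerA mulrC.
Qed.

Let contr : tens I P -> I := tens_lift contr_fun.

Let contrZ c x : contr (alg_in R c *: x) = c *: contr x.
Proof.
rewrite /contr; elim/tens_ind: x => [|x y Ex Ey|i p].
- by rewrite scaler0 !(tens_lift0 contr_bal) scaler0.
- by rewrite scalerDr !(tens_liftD contr_bal) Ex Ey scalerDr.
- rewrite tensorZr -tensorZ !(tens_liftE contr_bal) /contr_fun.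
  by rewrite !scalerA mulrC.
Qed.

Lemma contract_right_exists :
  exists f : {linear restr (alg_in R) (tens I P) -> I},
    forall i p, f (tensor i p) = (l p : C) *: i.
Proof.
have fl : linear (contr : restr (alg_in R) (tens I P) -> I).
  by move=> c x y; rewrite -contrZ; apply: (tens_liftD contr_bal).
exists (mk_linear fl) => i p; exact: (tens_liftE contr_bal).
Qed.

End ContractRight.

(** [I] is a direct summand of a power of [Q] over [C]: the map $h\mapsto(\mathrm{ev}(h\otimes
    p_n))_n$ is split by applying $\mathrm{id}\otimes l_n$ to the preimages and summing, since $\sum
    l_n(p_n)=1$. *)
Lemma tensor_factor_dual_basis :
  has_dual_basis (restr (alg_in R) Q) -> has_trace_one (restr (alg_in R) P) ->
  has_dual_basis I.
Proof.
case: ev_bij => s evK sK [M [z [zeta zE]]] [N [p [l l1]]].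
have /choice[f fE] n := contract_right_exists (l n).
have evp_lin n : linear (fun h : I => ev (tensor h (p n)) : restr (alg_in R) Q).
  by move=> c u v; rewrite tensorDl tensorZ -tensorZr linearP.
have sl : linear (s : restr (alg_in R) Q -> restr (alg_in R) (tens I P)).
  move=> c u v; apply: (can_inj evK); rewrite sK.
  by apply: esym; apply: etrans (linearP ev _ _ _) _; rewrite !sK.
pose S : {linear restr (alg_in R) Q -> restr (alg_in R) (tens I P)} :=
  mk_linear sl.
pose phi n m : {linear I -> C^o} := zeta m \o mk_linear (evp_lin n).
exists (N * M)%type, (fun k => f k.1 (s (z k.2))), (fun k => phi k.1 k.2) => h.
rewrite -(pair_bigA _ (fun n m => (phi n m h : C) *: f n (s (z m)))) /=.
rewrite -[LHS]scale1r -l1 scaler_suml; apply: eq_bigr => n _.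
transitivity (f n (S (ev (tensor h (p n))))); first by rewrite /S /= evK fE.
have SE w : S w = \sum_m (zeta m w : C) *: S (z m).
  by rewrite {1}(zE w) linear_sum; apply: eq_bigr => m _; rewrite linearZ.
rewrite SE linear_sum.
by apply: eq_bigr => m _; apply: (linearZ_LR (f n)).
Qed.

(** Each [z m] is a sum of values $\mathrm{ev}(h\otimes p)$, and
    $h\mapsto\zeta_m(\mathrm{ev}(h\otimes p))$ is a form on [I]. *)
Lemma tensor_factor_trace_one :
  has_trace_one (restr (alg_in R) Q) -> has_trace_one I.
Proof.
case: ev_bij => s evK sK [M [z [zeta zE]]]; apply: trace_ideal_one; rewrite -zE.
apply: (big_ind (@trace_ideal C I)) => [||m _].
- by exists [::]; rewrite big_nil.
- exact: trace_idealD.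
rewrite -[z m]sK; elim/tens_ind: (s (z m)) => [|x y Ex Ey|h p].
- by exists [::]; rewrite big_nil !linear0.
- by rewrite !linearD; apply: trace_idealD.
have evp_lin : linear (fun h : I => zeta m (ev (tensor h p)) : C^o).
  move=> c u v; rewrite tensorDl tensorZ -tensorZr.
  by rewrite linearD linearZ; apply: linearP (zeta m) c _ _.
by exists [:: (h, mk_linear evp_lin)]; rewrite big_seq1.
Qed.

End TensorFactor.

(** * Central endomorphisms, and the rank of the module of intertwiners *)

Section AzumayaEndRankOne.
Variables (C : comPzRingType) (A : algebra C).
Hypothesis A_azu : azumaya A.
Notation R := (op_alg A).

(** Commuting with the maps [elem_hom (w k) m] makes [z] the multiplication by $a=\sum w_k(z(p_k))$.
    Linearity of [z] and the trace identity make [a] central, hence a scalar from [C]. *)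
Lemma end_center (P : lmodType R) (z : endo P) : has_trace_one P ->
  (forall b, z * b = b * z) -> exists c, z = end_in P c.
Proof.
move=> [K [p [w w1]]] zC.
have [a za] : exists a : R, forall m, z m = a *: m.
  exists (\sum_k (w k (z (p k)) : R)) => m.
  rewrite -[LHS]scale1r -w1 !scaler_suml; apply: eq_bigr => k _.
  have := congr1 (fun b : endo P => b (p k)) (zC (elem_hom (w k) m)).
  by rewrite /= linearZ.
have aC (b : R) : a * b = b * a.
  rewrite -[LHS]mulr1 -[RHS]mulr1 -w1 !mulr_sumr; apply: eq_bigr => k _.
  rewrite -[LHS](linearZ_LR (w k)) -[RHS](linearZ_LR (w k)) -!scalerA -!za.
  by congr (w k _); apply: linearZ_LR.
have [c ac] := azumaya_center A_azu (fun b => esym (aC b)).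
by exists c; apply: linear_ext => m; rewrite za /= ac.
Qed.

Lemma intertwiner_rank_one (P Q : lmodType R)
    (psi : {rmorphism end_alg P -> end_alg Q}) :
  alg_iso psi -> has_dual_basis P -> has_trace_one P ->
  has_dual_basis Q -> has_trace_one Q ->
  rank_one_projective (intertwiner (psi : endo P -> endo Q)).
Proof.
move=> [psi_bij psiC] Pdual Ptr Qdual Qtr; set Psi := (psi : endo P -> endo Q).
have ev_bij := intertwiner_eval_bij A_azu psiC Pdual.
apply: rank_one_of_trace.
- apply: (tensor_factor_dual_basis ev_bij); first exact: restr_has_dual_basis.
  exact: restr_has_trace_one.
- move=> f x; case: (ev_bij) => s evK sK.
  (* Through $I\otimes P\cong Q$, the map $h\otimes p\mapsto f(h)x(p)$ becomes an endomorphism [t]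
     of [Q]. *)
  pose T (h : intertwiner Psi) (p : P) : Q := alg_in R (f h) *: x p.
  have Tbal : balanced T.
    rewrite /T; split=> [h h' p|h p p'|c h p].
    + by rewrite linearD rmorphD scalerDl.
    + by rewrite linearD scalerDr.
    + have -> : f (c *: h) = (c : C) * (f h : C) by apply: (linearZ_LR f).
      by rewrite linearZ !scalerA -rmorphM mulrC.
  have Tl : linear (tens_lift T).
    apply: tens_lift_linear Tbal _ => a h p.
    by rewrite /T linearZ !scalerA alg_inC.
  have sl : linear s.
    by move=> a u v; apply: (can_inj evK); rewrite linearP !sK.
  have tl : linear (fun q => tens_lift T (s q)) by move=> a u v; rewrite sl Tl.
  pose t : endo Q := mk_linear tl.
  have tE (h : intertwiner Psi) p : t (h p) = alg_in R (f h) *: x p.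
    by rewrite -(intertwiner_evalE h p) /= evK; apply: (tens_liftE Tbal).
  have tC b : t * Psi b = Psi b * t.
    apply: linear_ext => q; rewrite -[q]sK.
    elim/tens_ind: (s q) => [|u v Eu Ev|h p]; first by rewrite !linear0.
      by rewrite !linearD Eu Ev.
    rewrite intertwiner_evalE /= -[LHS]/(t (Psi b (h p))).
    rewrite -[RHS]/(Psi b (t (h p))).
    by rewrite -intertwinerP !tE intertwinerP linearZ.
  (* [psi] is onto, so [t] is central and its preimage in [end_alg P] is a scalar [c]; thus
     $f(h)x=ch$. *)
  case: psi_bij => psi' psiK psi'K.
  have [b|c zc] := @end_center P (psi' t) Ptr.
    by apply: (can_inj psiK); rewrite !rmorphM psi'K; apply: tC.
  exists c => h; apply: intertwiner_ext => p; rewrite /= -tE.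
  by rewrite -[t]psi'K zc psiC.
- apply: (tensor_factor_trace_one ev_bij); exact: restr_has_trace_one.
Qed.

End AzumayaEndRankOne.

(** * Duality with values in a bimodule *)

Lemma trace_one_faithful (R : pzRingType) (M : lmodType R) (a b : R) :
  has_trace_one M -> (forall m : M, a *: m = b *: m) -> a = b.
Proof.
move=> [J [x [f f1]]] ab; rewrite -[a]mulr1 -[b]mulr1 -f1 !mulr_sumr.
apply: eq_bigr => j _.
by rewrite -[LHS](linearZ_LR (f j)) -[RHS](linearZ_LR (f j)) /= ab.
Qed.

Section BihomDuality.
Variables (S T : pzRingType) (P : lmodType T^c) (K : bimodule S T).
Hypothesis K_progen : bimod_progenerator K.

Let Kdual : has_dual_basis (bimod_right K).
Proof. by case: K_progen => -[] *; apply/dual_basisP. Qed.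
Let Ktr : has_trace_one (bimod_right K).
Proof. by case: K_progen => -[] *; apply: generator_trace_one. Qed.

Let lactZ (s : S) a (k : K) : lact s (a *: k) = a *: lact s k.
Proof. exact: linearZ. Qed.
Let suml_lact (J : finType) (s : J -> S) (k : K) :
  lact (\sum_j s j) k = \sum_j lact (s j) k.
Proof.
rewrite /lact rmorph_sum.
exact: (big_morph (fun b : endo K => b k)).
Qed.

Let bihom_sumE (J : finType) (f : J -> bihom P K) p :
  (\sum_j f j : bihom P K) p = \sum_j f j p.
Proof. exact: (big_morph (fun f : bihom P K => f p)). Qed.

Let lact_inj (s t : S) : (forall k : K, lact s k = lact t k) -> s = t.
Proof.
case: K_progen => _ /(_ (bimod_left K t : endo K))[u [_ uniq]] st.
by rewrite -(uniq s) ?(uniq t) // => k; rewrite -/(lact t k) st.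
Qed.

(** The endomorphism $k'\mapsto k\,y(k')$ of [K] is the action of an element of [S]. This is the
    Morita pairing of [K] and its dual with values in [S]. *)
Let coeff_exists : exists coeff : {linear K -> T^c^o} -> K -> S,
  forall (y : {linear K -> T^c^o}) k k',
    lact (coeff y k) k' = (y k' : T^c) *: k.
Proof.
case: K_progen => _ Kend.
have /choice[e eP] (yk : {linear K -> T^c^o} * K) :
    exists s : S, forall k', lact s k' = (yk.1 k' : T^c) *: yk.2.
  have [s [sP _]] := Kend (elem_hom yk.1 yk.2).
  by exists s => k'; rewrite -sP.
by exists (fun y k => e (y, k)) => y k k'; rewrite eP.
Qed.

Let coeff := projT1 (cid coeff_exists).
Let coeffE y k k' : lact (coeff y k) k' = (y k' : T^c) *: k.
Proof. exact: (projT2 (cid coeff_exists)). Qed.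

Let coeff_lin y (p : P) : linear (fun f : bihom P K => coeff y (f p) : S^o).
Proof.
move=> s f g; apply: lact_inj => k.
rewrite coeffE /lact rmorphD rmorphM /= -!/(lact _ _) !coeffE lactZ.
by rewrite scalerDr.
Qed.

(** The sum of the coefficients acts on [K] by $k\mapsto\sum_lx_ly_l(k)=k$, and [S] acts
    faithfully. *)
Lemma bihom_has_trace_one : has_trace_one P -> has_trace_one (bihom P K).
Proof.
move=> [J [p [w w1]]]; have [L [x [y xy]]] := Kdual.
exists (L * J)%type, (fun i => elem_hom (w i.2) (x i.1) : bihom P K),
  (fun i => mk_linear (coeff_lin (y i.1) (p i.2))).
rewrite -(pair_bigA _ (fun l j => coeff (y l) ((w j (p j) : T^c) *: x l))) /=.
apply: lact_inj => k; rewrite suml_lact {2}/lact rmorph1 [RHS]xy.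
apply: eq_bigr => l _; rewrite suml_lact.
under eq_bigr => j _ do rewrite coeffE.
by rewrite -scaler_sumr -scaler_suml w1 scale1r.
Qed.

Section Expansion.
Variables (L J : finType) (x : L -> P) (y : L -> {linear P -> T^c^o}).
Variables (k : J -> K) (z : J -> {linear K -> T^c^o}).
Hypothesis xy : forall p, p = \sum_l (y l p : T^c) *: x l.
Hypothesis z1 : \sum_j z j (k j) = 1.

(** Expand $f(p)$ along the dual basis of [P], insert $1=\sum z_j(k_j)$, and turn each
    $f(x_l)z_j(k_j)$ into a left multiple of $k_j$ by [coeffE]. *)
Lemma bihom_expand (f : bihom P K) :
  f = \sum_l \sum_j coeff (z j) (f (x l)) *: (elem_hom (y l) (k j) : bihom P K).
Proof.
apply: linear_ext => p; rewrite {1}[p]xy linear_sum.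
transitivity (\sum_l \sum_j
    lact (coeff (z j) (f (x l))) ((y l p : T^c) *: k j)).
  apply: eq_bigr => l _; under eq_bigr => j _ do rewrite lactZ coeffE.
  by rewrite linearZ -scaler_sumr -scaler_suml z1 scale1r.
by rewrite bihom_sumE; apply: eq_bigr => l _; rewrite bihom_sumE.
Qed.

End Expansion.

Lemma bihom_has_dual_basis : has_dual_basis P -> has_dual_basis (bihom P K).
Proof.
move=> [L [x [y xy]]]; have [J [k [z z1]]] := Ktr.
exists (L * J)%type, (fun i => elem_hom (y i.1) (k i.2) : bihom P K),
  (fun i => mk_linear (coeff_lin (z i.2) (x i.1))) => f.
by rewrite {1}(bihom_expand xy z1 f) pair_bigA.
Qed.

Lemma precomp_lin (b : endo P) (f : bihom P K) : linear (fun p => f (b p)).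
Proof. by move=> a u v; rewrite !linearP. Qed.
Lemma precomp_lin2 (b : endo P) :
  linear (fun f : bihom P K => mk_linear (precomp_lin b f) : bihom P K).
Proof. by move=> s f g; apply: linear_ext. Qed.
Definition precomp (b : endo P) : endo (bihom P K) :=
  mk_linear (precomp_lin2 b).

Lemma precompD b d : precomp (b - d) = precomp b - precomp d.
Proof.
by apply: linear_ext => f; apply: linear_ext => p /=; rewrite linearB.
Qed.
Lemma precomp1 : precomp 1 = 1.
Proof. by apply: linear_ext => f; apply: linear_ext. Qed.
Lemma precompM b d : precomp (b * d) = precomp d * precomp b.
Proof. by apply: linear_ext => f; apply: linear_ext. Qed.

Lemma precomp_bij : has_dual_basis P -> bijective precomp.
Proof.
move=> [L [x [y xy]]]; have [J [k [z z1]]] := Ktr.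
pose g l j : bihom P K := elem_hom (y l) (k j).
pose inv_fun (phi : endo (bihom P K)) p : P :=
  \sum_l \sum_j (z j ((phi (g l j) : bihom P K) p) : T^c) *: x l.
have inv_lin phi : linear (inv_fun phi).
  move=> a u v; rewrite /inv_fun scaler_sumr -big_split; apply: eq_bigr => l _.
  rewrite scaler_sumr -big_split; apply: eq_bigr => j _.
  by rewrite !linearP scalerDl scalerA.
pose inv phi : endo P := mk_linear (inv_lin phi).
(* Expanding [f] by [bihom_expand] and using $S$-linearity of [phi] shows that [phi] is
   precomposition with [inv phi]. *)
have invE phi (f : bihom P K) p : f (inv phi p) = (phi f : bihom P K) p.
  rewrite [in RHS](bihom_expand xy z1 f) linear_sum.
  rewrite /inv /inv_fun /= linear_sum.
  rewrite bihom_sumE; apply: eq_bigr => l _; rewrite !linear_sum bihom_sumE.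
  by apply: eq_bigr => j _; rewrite !linearZ /= coeffE.
exists inv => [b|phi]; last first.
  by apply: linear_ext => f; apply: linear_ext => p /=; apply: invE.
(* The coordinates agree because they act in the same way on [K], which is faithful over [T]. *)
apply: linear_ext => p; rewrite [LHS]xy [RHS]xy; apply: eq_bigr => l _.
congr (_ *: _); apply: (trace_one_faithful Ktr) => m.
exact: (invE (precomp b) (elem_hom (y l) m) p).
Qed.

End BihomDuality.

(** * Equivalence of the three conditions through the anti-isomorphism [Phi] *)

Theorem theorem11p1
  (C : comPzRingType) (sigma : {rmorphism C -> C}) (sigma_bij : bijective sigma)
  (A : algebra C) (A_azumaya : azumaya A)
  (A_brauer : brauer_equiv (op_alg A) (twist_alg A sigma))
  (K : bimodule (op_alg A) (twist_alg A sigma))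
  (K_progen : bimod_progenerator K) (K_type : has_type K idfun)
  (P : lmodType (op_alg A)) (P_progen : progenerator P) :
  (* (a) <-> (b) *)
  (has_anti_automorphism (end_alg P) sigma <->
   exists I : lmodType C,
     rank_one_projective I /\ mod_isomorphic (tens I P) (dual1 K P)) /\
  (* (b) <-> (c) *)
  ((exists I : lmodType C,
     rank_one_projective I /\ mod_isomorphic (tens I P) (dual1 K P)) <->
   alg_isomorphic (end_alg P) (end_alg (dual1 K P))) /\
  ((forall I : lmodType C,
     rank_one_projective I -> ~ mod_isomorphic (tens I P) (dual1 K P)) ->
   ~ has_anti_automorphism (end_alg P) sigma).
Proof.
have [Pfg Ppr Pgen] := P_progen.
have Pdual : has_dual_basis P by apply/dual_basisP.
have Ptr := generator_trace_one Pgen.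
pose Phi : end_alg P -> end_alg (dual1 K P) :=
  @precomp _ (twist_alg A sigma) P K.
have Phi_bij : bijective Phi by apply: precomp_bij.
(* $f(p\,\sigma(c))=f(p)\,\sigma(c)$ is the right action of [c] on [K] through $A^\sigma$; by the
   type of [K] it equals the left action of [c]. *)
have PhiC c : Phi (alg_in _ (sigma c)) = alg_in _ c.
  apply: linear_ext => f; apply: linear_ext => p /=.
  rewrite [LHS](linearZ_LR (f : {linear P -> bimod_right K})).
  exact: esym (K_type c (f p)).
(* Composition with [Phi] or its inverse exchanges the two kinds of maps: two reversals of
   multiplication cancel, and [PhiC] cancels [sigma] on the center. *)
have ac : has_anti_automorphism (end_alg P) sigma <->
    alg_isomorphic (end_alg P) (end_alg (dual1 K P)).
  split=> [[alpha [alpha_bij alphaC]]|[psi [psi_bij psiC]]].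
    pose psi (b : end_alg P) := Phi (alpha b : end_alg P).
    have psiB : zmod_morphism psi.
      by move=> b d; rewrite /psi rmorphB; apply: precompD.
    have psiM : monoid_morphism psi.
      split=> [|b d]; rewrite /psi ?rmorph1 ?rmorphM; first exact: precomp1.
      exact: precompM.
    exists (mk_rmorphism psiB psiM); split.
      exact: (bij_comp Phi_bij alpha_bij).
    by move=> c; rewrite /= /psi alphaC PhiC.
  have [Phi' PhiK Phi'K] := Phi_bij.
  pose alpha (b : end_alg P) : (end_alg P)^c := Phi' (psi b).
  have alphaB : zmod_morphism alpha.
    move=> b d; apply: (can_inj PhiK); rewrite /alpha Phi'K rmorphB.
    rewrite -[psi b]Phi'K -[psi d]Phi'K; apply: esym; rewrite !PhiK.
    exact: precompD.
  have alphaM : monoid_morphism alpha.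
    split=> [|b d]; apply: (can_inj PhiK); rewrite /alpha Phi'K.
      by rewrite rmorph1; apply: esym; apply: precomp1.
    rewrite rmorphM -[psi b in LHS]Phi'K -[psi d in LHS]Phi'K; apply: esym.
    exact: precompM.
  exists (mk_rmorphism alphaB alphaM); split=> [|c] /=.
    by apply: bij_comp psi_bij; exists Phi.
  by rewrite /alpha psiC -PhiC PhiK.
have bc : (exists I : lmodType C,
     rank_one_projective I /\ mod_isomorphic (tens I P) (dual1 K P)) <->
   alg_isomorphic (end_alg P) (end_alg (dual1 K P)).
  split=> [[I [I1 /end_alg_iso]]|[psi psi_iso]].
    exact: alg_isomorphic_trans (end_tensor_rank_one P I1).
  exists (intertwiner (psi : endo P -> endo (dual1 K P))); split.
    apply: intertwiner_rank_one => //.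
      exact: bihom_has_dual_basis.
    exact: bihom_has_trace_one.
  case: psi_iso => _ psiC.
  exists (intertwiner_eval (psi : endo P -> endo (dual1 K P))).
  exact: intertwiner_eval_bij.
split; first by rewrite ac bc.
split=> // noI; rewrite ac -bc => -[I [I1 /(noI I I1)]].
by [].
Qed.
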